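(* For every integer $n\ge3$ there exist $\theta\in\mathbb{R}$ and $f=h+\overline{g}\in K_H^O$ with $h(z)+g(z)=\frac{z}{1-z}$ and dilatation $\omega(z)=\frac{g'(z)}{h'(z)}=e^{i\theta}z^n$ for $z\in\mathbb{D}$ such that $f_0*f\notin S_H^O$.
   Context: $\mathbb{D}$ is the open unit disk in $\mathbb{C}$. A complex-valued harmonic function $f$ on $\mathbb{D}$ with $f(0)=0$ is written $f=h+\overline{g}$ with $h,g$ analytic in $\mathbb{D}$ and $h(0)=g(0)=0$. $S_H^O$ is the class of complex-valued, harmonic, sense-preserving, univalent functions $f$ on $\mathbb{D}$ with $f(0)=0$, $f_z(0)=1$, $f_{\overline z}(0)=0$ (i.e. $h'(0)=1$, $g'(0)=0$). $K_H^O$ is the subclass of those $f\in S_H^O$ mapping $\mathbb{D}$ onto convex domains. The canonical harmonic right half-plane mapping is $$f_0(z)=h_0(z)+\overline{g_0(z)}=\frac{z-\frac12z^2}{(1-z)^2}-\overline{\frac{\frac12z^2}{(1-z)^2}}.$$ Harmonic convolution: if $f=h+\overline{g}$ and $F=H+\overline{G}$, then $f*F=h*H+\overline{g*G}$, where for analytic functions $\left(\sum_{n\ge1} a_nz^n\right)*\left(\sum_{n\ge1} A_nz^n\right)=\sum_{n\ge1} a_nA_nz^n$. *)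

(* Defs.v *)
(* Stdlib reals with Coquelicot's complex numbers [C] (= R * R). *)
From Stdlib Require Import Reals.
From Coquelicot Require Import Coquelicot.

Open Scope R_scope.

(* Functions on the unit disk are total functions on [C]; only their values on
   [disk] matter in everything below. *)
Definition disk (z : C) : Prop := Cmod z < 1.

Definition analytic_on_disk (h : C -> C) : Prop :=
  forall z : C, disk z -> @ex_derive C_AbsRing C_NormedModule h z.

(* Partial derivatives of u(x + iy) with respect to x and y. *)
Definition Dx (u : C -> R) (z : C) : R := Derive (fun x => u (x, Im z)) (Re z).
Definition Dy (u : C -> R) (z : C) : R := Derive (fun y => u (Re z, y)) (Im z).

Definition C1_on_disk (u : C -> R) : Prop :=
  forall z : C, disk z ->
    ex_derive (fun x => u (x, Im z)) (Re z) /\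
    ex_derive (fun y => u (Re z, y)) (Im z) /\
    @continuous C_UniformSpace R_UniformSpace (Dx u) z /\
    @continuous C_UniformSpace R_UniformSpace (Dy u) z.

Definition real_harmonic (u : C -> R) : Prop :=
  C1_on_disk u /\ C1_on_disk (Dx u) /\ C1_on_disk (Dy u) /\
  forall z : C, disk z -> Dx (Dx u) z + Dy (Dy u) z = 0.

Definition re_part (f : C -> C) (z : C) : R := Re (f z).
Definition im_part (f : C -> C) (z : C) : R := Im (f z).

Definition harmonic (f : C -> C) : Prop :=
  real_harmonic (re_part f) /\ real_harmonic (im_part f).

Definition jacobian (f : C -> C) (z : C) : R :=
  Dx (re_part f) z * Dy (im_part f) z - Dy (re_part f) z * Dx (im_part f) z.

Definition sense_preserving (f : C -> C) : Prop :=
  forall z : C, disk z -> 0 < jacobian f z.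

Definition univalent (f : C -> C) : Prop :=
  forall z1 z2 : C, disk z1 -> disk z2 -> f z1 = f z2 -> z1 = z2.

(* Wirtinger derivatives f_z = (f_x - i f_y) / 2, f_zbar = (f_x + i f_y) / 2. *)
Definition Dz (f : C -> C) (z : C) : C :=
  ((((Dx (re_part f) z, Dx (im_part f) z) : C)
    - Ci * (Dy (re_part f) z, Dy (im_part f) z)) / 2)%C.
Definition Dzbar (f : C -> C) (z : C) : C :=
  ((((Dx (re_part f) z, Dx (im_part f) z) : C)
    + Ci * (Dy (re_part f) z, Dy (im_part f) z)) / 2)%C.

Definition S_HO (f : C -> C) : Prop :=
  harmonic f /\ sense_preserving f /\ univalent f /\
  f 0 = 0 /\ Dz f 0 = 1 /\ Dzbar f 0 = 0.

Definition disk_image (f : C -> C) (w : C) : Prop :=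
  exists z : C, disk z /\ f z = w.

Definition convex (A : C -> Prop) : Prop :=
  forall (w1 w2 : C) (t : R), A w1 -> A w2 -> 0 <= t <= 1 ->
    A ((1 - t) * w1 + t * w2)%C.

(* Nonemptiness and connectedness are automatic for the convex set f(D). *)
Definition K_HO (f : C -> C) : Prop :=
  S_HO f /\ @open C_UniformSpace (disk_image f) /\ convex (disk_image f).

(* f = h + conj g on the disk, with h and g analytic there and
   h(0) = g(0) = 0; this determines h and g on the disk. *)
Definition canonical_decomposition (f h g : C -> C) : Prop :=
  analytic_on_disk h /\ analytic_on_disk g /\ h 0 = 0 /\ g 0 = 0 /\
  forall z : C, disk z -> f z = (h z + Cconj (g z))%C.

(* Power series are indexed from 0; the constant coefficient is a 0 = h(0). *)
Definition has_expansion (h : C -> C) (a : nat -> C) : Prop :=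
  forall z : C, disk z -> @is_pseries C_AbsRing C_NormedModule a z (h z).

(* k = h * H on the disk.  The coefficient sequences are determined by h and
   H, so k is determined on the disk. *)
Definition is_analytic_convolution (h H k : C -> C) : Prop :=
  exists a A : nat -> C,
    has_expansion h a /\ has_expansion H A /\
    has_expansion k (fun n => (a n * A n)%C).

(* P = f * F on the disk. *)
Definition is_harmonic_convolution (f F P : C -> C) : Prop :=
  exists h g H G k l : C -> C,
    canonical_decomposition f h g /\ canonical_decomposition F H G /\
    is_analytic_convolution h H k /\ is_analytic_convolution g G l /\
    forall z : C, disk z -> P z = (k z + Cconj (l z))%C.

Definition f0 (z : C) : C :=
  ((z - / 2 * z ^ 2) / (1 - z) ^ 2 - Cconj ((/ 2 * z ^ 2) / (1 - z) ^ 2))%C.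

(* e^{i theta} *)
Definition cis (theta : R) : C := (cos theta, sin theta).

(* Main.v *)
Require Import Defs.
From Stdlib Require Import Reals Arith Lra Lia Psatz IndefiniteDescription.
From Coquelicot Require Import Coquelicot.

(** Take theta = PI, so that h' = 1 / ((1 - z)^2 (1 - z^n)) and g' = - z^n h'.
    On the line Re w = c of the half-plane Re w > -1/2, w = z / (1 - z), the real part of f
    is constant, and Im f = Im (h - g) has derivative Re ((1 + z^n) / (1 - z^n)) >= (1 + 2 c) / n^2.
    So f maps the disk bijectively onto the half-plane.

    The convolution is (h + z h') / 2 + conj ((g - z g') / 2).  Its dilatation is
    z^n p / q with p = n - (n - 2) z - 2 z^(n+1) and q = 2 + (n - 2) z^n - n z^(n+1);
    it has modulus at least 1 at r zeta whenever zeta^(n+1) = 1, zeta <> 1 and r < 1 is close to 1,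
    so the convolution is not sense-preserving. *)

(** * Complex derivatives *)

(** Since h' + g' = 1/(1 - z)^2 is the derivative of w = z/(1 - z), the choice g' = -z^n h' turns
    the w-derivative of h - g into (1 + z^n)/(1 - z^n), whose real part is positive. Positivity
    alone gives injectivity on each vertical line; the lower bound, uniform along the line, is what
    makes Im f reach every real value, so that the image is the whole half-plane and its convexity
    is immediate.

    The threshold n >= 3 comes from q. On |z| = 1 one has q = -z^(n+1) conj(p), hence |p| = |q|
    there; the zeros of q have a product of modulus 2/n < 1, so q vanishes somewhere in the disk and
    sense-preservation must fail. The proof exhibits an explicit point near the boundary, comparing
    |q| with |z^n p| so as never to divide by q.

    Convolution is defined through coefficients, so h is built from its Taylor series. Polynomial
    bounds on coefficients suffice for convergence on the disk and for termwise differentiation.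
    Harmonicity and the Jacobian are stated with real partial derivatives, which are reached by
    writing Re f and Im f as real parts of holomorphic functions. *)

Definition is_Cderive (f : C -> C) (z l : C) : Prop :=
  @is_derive C_AbsRing C_NormedModule f z l.

(** Balls of [C_AbsRing] are round disks, those of [C_UniformSpace] are products of intervals.
    Complex derivatives use the former and continuity of partial derivatives the latter; [locally_C]
    passes between them. *)
Lemma locally_C_Cmod (z : C) (P : C -> Prop) :
  @locally (AbsRing_UniformSpace C_AbsRing) z P <->
  exists d : R, 0 < d /\ forall w : C, Cmod (w - z) < d -> P w.
Proof.
split.
- intros [d Hd]. exists d. split; [apply cond_pos | exact Hd].
- intros [d [Hd H]]. exists (mkposreal d Hd). exact H.
Qed.

Lemma locally_disk (z : C) : disk z -> @locally C_UniformSpace z disk.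
Proof.
intros Hz. apply locally_C, locally_C_Cmod. exists (1 - Cmod z).
unfold disk in *. split; [lra|]. intros w Hw.
replace w with (z + (w - z))%C by ring.
pose proof (Cmod_triangle z (w - z)). lra.
Qed.

Lemma is_Cderive_eps (f : C -> C) (z l : C) :
  is_Cderive f z l <->
  forall eps : R, 0 < eps -> exists d : R, 0 < d /\
    forall w : C, Cmod (w - z) < d ->
      Cmod (f w - f z - l * (w - z)) <= eps * Cmod (w - z).
Proof.
split.
- intros [_ H] eps Heps.
  specialize (H z (fun P HP => HP) (mkposreal eps Heps)).
  apply locally_C_Cmod in H. destruct H as [d [Hd H]].
  exists d. split; [exact Hd|]. intros w Hw.
  specialize (H w Hw). simpl in H.
  replace (f w - f z - l * (w - z))%C with (f w - f z - (w - z) * l)%C by ring.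
  exact H.
- intros H. split.
  + apply is_linear_scal_l.
  + intros x Hx.
    assert (E : z = x).
    { apply (is_filter_lim_locally_unique (V := AbsRing_NormedModule C_AbsRing)). exact Hx. }
    subst x. intros eps. apply locally_C_Cmod.
    destruct (H eps (cond_pos eps)) as [d [Hd Hw]].
    exists d. split; [exact Hd|]. intros w Hwz. specialize (Hw w Hwz).
    replace (f w - f z - l * (w - z))%C with (f w - f z - (w - z) * l)%C in Hw by ring.
    exact Hw.
Qed.

Lemma is_Cderive_eq (f : C -> C) (z l l' : C) :
  is_Cderive f z l -> l = l' -> is_Cderive f z l'.
Proof. intros H <-. exact H. Qed.

(** The product rule and the inner function of the chain rule live in
    [AbsRing_NormedModule C_AbsRing], the definitions in [C_NormedModule]. The norms coincide, so
    the remainder estimate carries over unchanged. *)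
Lemma is_Cderive_iff (f : C -> C) (z l : C) :
  is_Cderive f z l <-> @is_derive C_AbsRing (AbsRing_NormedModule C_AbsRing) f z l.
Proof.
split.
- intros [_ H]. split; [apply is_linear_scal_l | exact H].
- intros [_ H]. split; [apply is_linear_scal_l | exact H].
Qed.

Lemma is_Cderive_mult (f g : C -> C) (z a b : C) :
  is_Cderive f z a -> is_Cderive g z b ->
  is_Cderive (fun w => f w * g w)%C z (a * g z + f z * b)%C.
Proof.
rewrite !is_Cderive_iff. intros Hf Hg.
apply (is_derive_mult (K := C_AbsRing) f g z a b Hf Hg). exact Cmult_comm.
Qed.

Lemma is_Cderive_comp (f g : C -> C) (z a b : C) :
  is_Cderive f (g z) a -> is_Cderive g z b ->
  is_Cderive (fun w => f (g w)) z (b * a)%C.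
Proof.
intros Hf Hg. apply is_Cderive_iff in Hg.
exact (is_derive_comp (K := C_AbsRing) (V := C_NormedModule) f g z a b Hf Hg).
Qed.

Lemma is_Cderive_plus (f g : C -> C) (z a b : C) :
  is_Cderive f z a -> is_Cderive g z b ->
  is_Cderive (fun w => f w + g w)%C z (a + b)%C.
Proof. apply (is_derive_plus (K := C_AbsRing) (V := C_NormedModule)). Qed.

Lemma is_Cderive_minus (f g : C -> C) (z a b : C) :
  is_Cderive f z a -> is_Cderive g z b ->
  is_Cderive (fun w => f w - g w)%C z (a - b)%C.
Proof. apply (is_derive_minus (K := C_AbsRing) (V := C_NormedModule)). Qed.

Lemma is_Cderive_const (c z : C) : is_Cderive (fun _ => c) z 0%C.
Proof. apply (is_derive_const (K := C_AbsRing) (V := C_NormedModule)). Qed.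

Lemma is_Cderive_id (z : C) : is_Cderive (fun w => w) z 1%C.
Proof. apply is_Cderive_iff. apply (is_derive_id (K := C_AbsRing)). Qed.

Lemma is_Cderive_scal (c : C) (f : C -> C) (z a : C) :
  is_Cderive f z a -> is_Cderive (fun w => c * f w)%C z (c * a)%C.
Proof.
intros H. eapply is_Cderive_eq.
- apply is_Cderive_mult; [apply is_Cderive_const | exact H].
- cbv beta. ring.
Qed.

Lemma is_Cderive_pow (n : nat) (z : C) :
  is_Cderive (fun w => w ^ n)%C z (INR n * z ^ (pred n))%C.
Proof.
induction n as [|n IH].
- eapply is_Cderive_eq; [apply (is_Cderive_const 1)|]. simpl. ring.
- eapply is_Cderive_eq.
  + apply (is_Cderive_mult (fun w => w) (fun w => w ^ n)%C); [apply is_Cderive_id | exact IH].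
  + rewrite S_INR, RtoC_plus. destruct n as [|n]; [simpl; ring|].
    generalize (INR (S n)). intros c. simpl. ring.
Qed.

Lemma is_Cderive_inv (f : C -> C) (z a : C) :
  is_Cderive f z a -> f z <> 0%C ->
  is_Cderive (fun w => / f w)%C z (- a / (f z) ^ 2)%C.
Proof.
intros Hf Hz.
eapply is_Cderive_eq.
- apply (is_Cderive_comp Cinv f z (- / (f z) ^ 2)%C a); [|exact Hf].
  apply is_Cderive_eps. intros eps Heps.
  set (u := f z) in *. pose proof (proj1 (Cmod_gt_0 u) Hz) as Hu.
  (* The remainder is (w - u)^2 / (u^2 w). The first radius gives |w| > |u|/2, hence the bound 2 |w
     - u|^2 / |u|^3; the second makes this at most eps |w - u|. *)
  exists (Rmin (Cmod u / 2) (eps * Cmod u ^ 3 / 2)). split.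
  { apply Rmin_pos; [lra|]. pose proof (pow_lt _ 3 Hu). nra. }
  intros w Hw.
  assert (H1 : Cmod (w - u) < Cmod u / 2) by (eapply Rlt_le_trans; [exact Hw | apply Rmin_l]).
  assert (H2 : Cmod (w - u) < eps * Cmod u ^ 3 / 2) by (eapply Rlt_le_trans; [exact Hw | apply Rmin_r]).
  assert (Hw2 : Cmod u / 2 < Cmod w).
  { pose proof (Cmod_triangle w (- (w - u))) as T.
    replace (w + - (w - u))%C with u in T by ring. rewrite Cmod_opp in T. lra. }
  assert (Hw0 : w <> 0%C) by (apply Cmod_gt_0; lra).
  replace (/ w - / u - - / u ^ 2 * (w - u))%C with ((w - u) * ((w - u) * / (u ^ 2 * w)))%C
    by (field; split; assumption).
  rewrite Cmod_mult, Rmult_comm. apply Rmult_le_compat_r; [apply Cmod_ge_0|].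
  rewrite Cmod_mult, Cmod_inv, Cmod_mult, Cmod_pow
    by (apply Cmult_neq_0; [apply Cpow_nz; exact Hz | exact Hw0]).
  assert (P : 0 < Cmod u ^ 2 * Cmod w) by (apply Rmult_lt_0_compat; [apply pow_lt|]; lra).
  apply Rmult_le_reg_r with (Cmod u ^ 2 * Cmod w); [exact P|].
  rewrite Rmult_assoc, Rinv_l by lra.
  pose proof (pow_lt _ 2 Hu).
  assert (eps * Cmod u ^ 3 / 2 = eps * (Cmod u ^ 2 * (Cmod u / 2))) as E by (simpl; field).
  rewrite Rmult_1_r.
  apply Rle_trans with (eps * (Cmod u ^ 2 * (Cmod u / 2))); [lra|].
  apply Rmult_le_compat_l; [lra|]. apply Rmult_le_compat_l; lra.
- field. exact Hz.
Qed.

Lemma is_Cderive_continuous (f : C -> C) (z l : C) :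
  is_Cderive f z l -> @continuous C_UniformSpace C_UniformSpace f z.
Proof.
intros H.
assert (E : ex_derive (K := C_AbsRing) (V := C_NormedModule) f z) by (exists l; exact H).
apply ex_derive_continuous in E.
intros P HP. apply locally_C. apply E. exact HP.
Qed.

(** The chain rule along a real line, with |Re u| <= |u| transferring the remainder. The directions
    1 and [Ci] yield the two partial derivatives. *)
Lemma is_derive_Re_line (phi : C -> C) (p e l : C) (t : R) :
  is_Cderive phi (p + t * e)%C l ->
  is_derive (fun s : R => Re (phi (p + s * e)%C)) t (Re (e * l)%C).
Proof.
intros H. apply is_derive_Reals. intros eps Heps.
(* The summand 1 keeps the quotient meaningful for e = 0; the factor 2 provides the strict
   inequality of the real derivative. *)
destruct (proj1 (is_Cderive_eps _ _ _) H (eps / (2 * (Cmod e + 1)))) as [d [Hd K]].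
{ apply Rdiv_lt_0_compat; pose proof (Cmod_ge_0 e); lra. }
pose proof (Cmod_ge_0 e) as He.
assert (Hd' : 0 < d / (Cmod e + 1)) by (apply Rdiv_lt_0_compat; lra).
exists (mkposreal _ Hd'). intros s Hs0 Hs. simpl in Hs.
specialize (K (p + (t + s)%R * e)%C).
replace (p + (t + s)%R * e - (p + t * e))%C with (s * e)%C in K by (rewrite RtoC_plus; ring).
rewrite Cmod_mult, Cmod_R in K.
assert (Hse : Rabs s * Cmod e <= Rabs s * (Cmod e + 1)) by (pose proof (Rabs_pos s); nra).
assert (Hsd : Rabs s * (Cmod e + 1) < d).
{ apply Rmult_lt_compat_r with (r := Cmod e + 1) in Hs; [|lra].
  replace (d / (Cmod e + 1) * (Cmod e + 1)) with d in Hs by (field; lra). exact Hs. }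
specialize (K ltac:(lra)).
pose proof (re_le_Cmod (phi (p + (t + s)%R * e) - phi (p + t * e) - l * (s * e))%C) as M.
assert (E : Re (phi (p + (t + s)%R * e) - phi (p + t * e) - l * (s * e))%C
  = Re (phi (p + (t + s)%R * e)%C) - Re (phi (p + t * e)%C) - Re (e * l)%C * s).
{ unfold Re, Im. simpl. ring. }
rewrite E in M.
replace ((Re (phi (p + (t + s)%R * e)%C) - Re (phi (p + t * e)%C)) / s - Re (e * l)%C)
  with ((Re (phi (p + (t + s)%R * e)%C) - Re (phi (p + t * e)%C) - Re (e * l)%C * s) / s)
  by (field; exact Hs0).
rewrite Rabs_div by exact Hs0.
pose proof (Rabs_pos_lt s Hs0) as Hs1.
apply Rmult_lt_reg_r with (Rabs s); [exact Hs1|].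
replace (Rabs (Re (phi (p + (t + s)%R * e)%C) - Re (phi (p + t * e)%C) - Re (e * l)%C * s) / Rabs s * Rabs s)
  with (Rabs (Re (phi (p + (t + s)%R * e)%C) - Re (phi (p + t * e)%C) - Re (e * l)%C * s))
  by (field; lra).
assert (eps / (2 * (Cmod e + 1)) * (Rabs s * Cmod e) <= eps / 2 * Rabs s).
{ apply Rle_trans with (eps / (2 * (Cmod e + 1)) * (Rabs s * (Cmod e + 1))).
  - apply Rmult_le_compat_l; [|exact Hse]. apply Rlt_le, Rdiv_lt_0_compat; lra.
  - right. field. lra. }
nra.
Qed.

Lemma is_derive_Re_x (phi : C -> C) (z l : C) :
  is_Cderive phi z l ->
  is_derive (fun x : R => Re (phi (x, Im z))) (Re z) (Re l).
Proof.
intros H.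
apply is_derive_ext with (fun x : R => Re (phi ((0, Im z) + x * 1)%C)).
{ intros x. do 2 f_equal. apply injective_projections; cbn; ring. }
replace (Re l) with (Re (1 * l)%C) by (f_equal; ring).
apply is_derive_Re_line.
replace ((0, Im z) + Re z * 1)%C with z by (destruct z; apply injective_projections; cbn; ring).
exact H.
Qed.

Lemma is_derive_Re_y (phi : C -> C) (z l : C) :
  is_Cderive phi z l ->
  is_derive (fun y : R => Re (phi (Re z, y))) (Im z) (Re (Ci * l)%C).
Proof.
intros H.
apply is_derive_ext with (fun y : R => Re (phi ((Re z, 0) + y * Ci)%C)).
{ intros y. do 2 f_equal. apply injective_projections; cbn; ring. }
apply is_derive_Re_line.
replace ((Re z, 0) + Im z * Ci)%C with z by (destruct z; apply injective_projections; cbn; ring).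
exact H.
Qed.

(** * Power series with polynomially bounded coefficients *)

Lemma ex_series_poly_geom (m : nat) (r : R) :
  0 <= r < 1 -> ex_series (fun k => INR (S k) ^ m * r ^ k).
Proof.
assert (P : forall r, 0 < r < 1 -> ex_series (fun k => INR (S k) ^ m * r ^ k)).
{ clear r. intros r Hr.
  assert (Hpos : forall k, 0 < INR (S k) ^ m * r ^ k).
  { intros k. apply Rmult_lt_0_compat; apply pow_lt; [apply lt_0_INR; lia | lra]. }
  apply ex_series_ext with (fun k => Rabs (INR (S k) ^ m * r ^ k)).
  { intros k. apply Rabs_pos_eq, Rlt_le, Hpos. }
  apply ex_series_DAlembert with r; [lra | intros k; apply Rgt_not_eq, Hpos |].
  apply is_lim_seq_ext with (fun k => (1 + / INR (S k)) ^ m * r).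
  { intros k. rewrite Rabs_pos_eq by (apply Rlt_le, Rdiv_lt_0_compat; apply Hpos).
    assert (H : INR (S k) <> 0) by (apply not_0_INR; lia).
    rewrite (S_INR (S k)).
    replace (INR (S k) + 1) with (INR (S k) * (1 + / INR (S k))) by (field; exact H).
    rewrite Rpow_mult_distr. simpl pow. field. split; [apply pow_nonzero; lra|].
    apply pow_nonzero, H. }
  replace (Finite r) with (Finite (1 ^ m * r)) by (rewrite pow1; f_equal; ring).
  apply is_lim_seq_mult' with (l1 := 1 ^ m); [|apply is_lim_seq_const].
  apply (is_lim_seq_continuous (fun x => x ^ m) (fun k => 1 + / INR (S k))).
  { apply derivable_continuous_pt, derivable_pt_pow. }
  replace (Finite 1) with (Finite (1 + 0)) by (f_equal; ring).
  apply is_lim_seq_plus'; [apply is_lim_seq_const|].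
  apply (is_lim_seq_incr_1 (fun k => / INR k)).
  replace (Finite 0) with (Rbar_inv p_infty) by reflexivity.
  apply is_lim_seq_inv; [apply is_lim_seq_INR | discriminate]. }
intros Hr.
apply ex_series_Rabs.
(* The ratio test requires nonzero terms, which excludes r = 0; comparison with the radius (r + 1)/2
   > 0 covers it. *)
apply (@ex_series_le R_AbsRing R_CompleteNormedModule) with (fun k => INR (S k) ^ m * ((r + 1) / 2) ^ k);
  [|apply P; lra].
intros k. change (norm (Rabs (INR (S k) ^ m * r ^ k))) with (Rabs (Rabs (INR (S k) ^ m * r ^ k))).
pose proof (pow_le (INR (S k)) m (pos_INR _)).
rewrite Rabs_Rabsolu, Rabs_pos_eq by (apply Rmult_le_pos; [easy | apply pow_le; lra]).
apply Rmult_le_compat_l; [easy|]. apply pow_incr. lra.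
Qed.

Lemma is_series_Cmod_le (t : nat -> C) (l : C) (c : nat -> R) :
  @is_series C_AbsRing C_NormedModule t l -> (forall k, Cmod (t k) <= c k) ->
  ex_series c -> Cmod l <= Series c.
Proof.
intros Ht Hc Ex.
assert (L : is_lim_seq (fun N => Cmod (@sum_n C_AbelianMonoid t N)) (Cmod l)).
{ apply filterlim_comp with (1 := Ht).
  exact (@filterlim_norm C_AbsRing C_NormedModule l). }
assert (L' : is_lim_seq (fun N => sum_n c N) (Series c)) by (apply Series_correct; exact Ex).
change (Rbar_le (Cmod l) (Series c)).
refine (is_lim_seq_le _ _ _ _ _ L L'). intros N.
apply Rle_trans with (sum_n (fun k => Cmod (t k)) N).
- apply (@norm_sum_n_m C_AbsRing C_NormedModule).
- apply sum_n_m_le. exact Hc.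
Qed.

Definition poly_bounded (b : nat -> C) (m : nat) : Prop :=
  forall k, Cmod (b k) <= INR (S k) ^ m.

(** The series converges absolutely at each point of the disk; choice assembles the sums into one
    function, with arbitrary values off the disk. *)
Lemma poly_bounded_has_expansion (b : nat -> C) (m : nat) :
  poly_bounded b m -> exists h : C -> C, has_expansion h b.
Proof.
intros Hb.
destruct (functional_choice (fun z l => disk z -> @is_pseries C_AbsRing C_NormedModule b z l))
  as [h Hh].
- intros z. destruct (Rlt_dec (Cmod z) 1) as [Hz|Hz].
  + destruct (@ex_series_le C_AbsRing C_CompleteNormedModule
      (fun k => @scal C_AbsRing C_NormedModule (@pow_n C_Ring z k) (b k))
      (fun k => INR (S k) ^ m * Cmod z ^ k)) as [l Hl].
    * intros k.
      change (Cmod (z ^ k * b k) <= INR (S k) ^ m * Cmod z ^ k).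
      rewrite Cmod_mult, Cmod_pow, Rmult_comm.
      apply Rmult_le_compat_r; [apply pow_le, Cmod_ge_0 | apply Hb].
    * apply ex_series_poly_geom. split; [apply Cmod_ge_0 | exact Hz].
    * exists l. intros _. exact Hl.
  + exists (RtoC 0). intros H. contradiction.
- exists h. exact Hh.
Qed.

Lemma has_expansion_ext (h h' : C -> C) (a a' : nat -> C) :
  has_expansion h a -> (forall z, disk z -> h z = h' z) -> (forall k, a k = a' k) ->
  has_expansion h' a'.
Proof.
intros H Eh Ea z Hz. rewrite <- (Eh z Hz).
apply is_pseries_ext with a; [exact Ea | exact (H z Hz)].
Qed.

Lemma has_expansion_plus (h g : C -> C) (a b : nat -> C) :
  has_expansion h a -> has_expansion g b ->
  has_expansion (fun z => h z + g z)%C (fun k => a k + b k)%C.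
Proof.
intros Ha Hb z Hz.
exact (@is_pseries_plus C_AbsRing C_NormedModule a b z _ _ (Ha z Hz) (Hb z Hz)).
Qed.

Lemma has_expansion_minus (h g : C -> C) (a b : nat -> C) :
  has_expansion h a -> has_expansion g b ->
  has_expansion (fun z => h z - g z)%C (fun k => a k - b k)%C.
Proof.
intros Ha Hb z Hz.
exact (@is_pseries_minus C_AbsRing C_NormedModule a b z _ _ (Ha z Hz) (Hb z Hz)).
Qed.

Lemma has_expansion_scal (c : C) (h : C -> C) (a : nat -> C) :
  has_expansion h a -> has_expansion (fun z => c * h z)%C (fun k => c * a k)%C.
Proof.
intros Ha z Hz.
exact (@is_pseries_scal C_AbsRing C_NormedModule c a z _ (Cmult_comm z c) (Ha z Hz)).
Qed.

Definition shift (a : nat -> C) (k : nat) : C :=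
  match k with O => 0%C | S k => a k end.

Lemma has_expansion_shift (h : C -> C) (a : nat -> C) :
  has_expansion h a -> has_expansion (fun z => z * h z)%C (shift a).
Proof.
intros Ha z Hz.
exact (@is_pseries_incr_1 C_AbsRing C_NormedModule a z _ (Ha z Hz)).
Qed.

Lemma has_expansion_at_0 (h : C -> C) (a : nat -> C) :
  has_expansion h a -> h 0%C = a O.
Proof.
intros H. assert (D : disk 0%C) by (unfold disk; rewrite Cmod_0; lra).
pose proof (@is_pseries_0 C_AbsRing C_NormedModule a) as H'.
specialize (H _ D).
exact (@filterlim_locally_unique nat C_AbsRing C_NormedModule eventually _ _ _ _ H H').
Qed.

Lemma has_expansion_1 :
  has_expansion (fun _ => 1%C) (fun k => match k with O => 1%C | S _ => 0%C end).
intros z _. unfold is_pseries, is_series.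
apply filterlim_ext with (fun _ : nat => RtoC 1).
- intros k. symmetry. induction k as [|k IH].
  + rewrite sum_O. change (1 * 1 = 1)%C. ring.
  + rewrite sum_Sn, IH.
    change (1 + @pow_n C_Ring z (S k) * 0 = 1)%C. ring.
- apply filterlim_const.
Qed.

Lemma is_series_C_unique (t : nat -> C) (l l' : C) :
  @is_series C_AbsRing C_NormedModule t l -> @is_series C_AbsRing C_NormedModule t l' -> l = l'.
Proof.
exact (@filterlim_locally_unique nat C_AbsRing C_NormedModule eventually _ _ l l').
Qed.

Lemma has_expansion_unique (h h' : C -> C) (a : nat -> C) (z : C) :
  has_expansion h a -> has_expansion h' a -> disk z -> h z = h' z.
Proof. intros H H' Hz. exact (is_series_C_unique _ _ _ (H z Hz) (H' z Hz)). Qed.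

Lemma disk_neq_1 (z : C) : disk z -> (1 - z)%C <> 0%C.
Proof.
intros Hz E. assert (z = 1%C) as -> by (replace z with (1 - (1 - z))%C by ring; rewrite E; ring).
unfold disk in Hz. rewrite Cmod_1 in Hz. lra.
Qed.

(** Division by 1 - z without a Cauchy product: if G is the sum of the series with the partial sums
    as coefficients, then (1 - z) G telescopes to the series of [h], and sums are unique. Each
    division raises the exponent of the coefficient bound by one. *)
Lemma has_expansion_partial_sums (h : C -> C) (b : nat -> C) (m : nat) :
  poly_bounded b m -> has_expansion h b ->
  poly_bounded (@sum_n C_AbelianMonoid b) (S m) /\
  has_expansion (fun z => h z / (1 - z))%C (@sum_n C_AbelianMonoid b).
Proof.
intros Hb Hh.
assert (B : poly_bounded (@sum_n C_AbelianMonoid b) (S m)).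
{ intros k. induction k as [|k IH].
  - rewrite sum_O. specialize (Hb O). simpl in *. rewrite pow1 in *. lra.
  - rewrite sum_Sn.
    apply Rle_trans with (1 := Cmod_triangle (@sum_n C_AbelianMonoid b k) (b (S k))).
    specialize (Hb (S k)).
    assert (Q : INR (S k) ^ m <= INR (S (S k)) ^ m).
    { apply pow_incr. split; [apply pos_INR|]. apply le_INR. lia. }
    assert (X : 0 <= INR (S k)) by apply pos_INR.
    apply Rle_trans with (INR (S k) * INR (S k) ^ m + INR (S (S k)) ^ m).
    { apply Rplus_le_compat; [exact IH | exact Hb]. }
    change (INR (S (S k)) ^ S m) with (INR (S (S k)) * INR (S (S k)) ^ m).
    rewrite (S_INR (S k)) in *. nra. }
split; [exact B|].
destruct (poly_bounded_has_expansion _ _ B) as [g Hg].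
apply (has_expansion_ext g _ _ _ Hg); [|reflexivity].
intros z Hz. pose proof (disk_neq_1 z Hz) as Hz1.
assert (E : (g z - z * g z)%C = h z).
{ apply (has_expansion_unique (fun z => g z - z * g z)%C h b); [|exact Hh|exact Hz].
  apply (has_expansion_ext _ _ _ _ (has_expansion_minus _ _ _ _ Hg (has_expansion_shift _ _ Hg)));
    [reflexivity|].
  intros [|k]; simpl shift.
  - rewrite sum_O. ring.
  - rewrite sum_Sn. change (@plus C_AbelianMonoid) with Cplus. ring. }
rewrite <- E. field. exact Hz1.
Qed.

(** * The series of 1 / (1 - z^n) *)

Definition geom_coeff (n k : nat) : C :=
  if Nat.eq_dec (k mod n) 0 then 1%C else 0%C.

Lemma has_expansion_shift_n (n : nat) (h : C -> C) (a : nat -> C) :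
  has_expansion h a -> has_expansion (fun z => z ^ n * h z)%C (Nat.iter n shift a).
Proof.
intros H. induction n as [|n IH].
- apply (has_expansion_ext _ _ _ _ H); [|reflexivity]. intros. simpl. ring.
- apply (has_expansion_ext _ _ _ _ (has_expansion_shift _ _ IH)); [|reflexivity].
  intros. simpl. ring.
Qed.

Lemma iter_shift (n : nat) (a : nat -> C) (k : nat) :
  Nat.iter n shift a k = if lt_dec k n then 0%C else a (k - n)%nat.
Proof.
revert k. induction n as [|n IH]; intros k; simpl.
- rewrite Nat.sub_0_r. reflexivity.
- destruct k as [|k]; simpl; [reflexivity|]. rewrite IH.
  destruct (lt_dec k n), (lt_dec (S k) (S n)); try lia; reflexivity.
Qed.

Lemma disk_pow_neq_1 (n : nat) (z : C) :
  (0 < n)%nat -> disk z -> (1 - z ^ n)%C <> 0%C.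
Proof.
intros Hn Hz. apply disk_neq_1. unfold disk in *. rewrite Cmod_pow.
apply pow_lt_1_compat; [|exact Hn]. split; [apply Cmod_ge_0 | exact Hz].
Qed.

(** Again by telescoping: subtracting the series shifted by n places leaves only the constant term
    1. *)
Lemma has_expansion_geom (n : nat) :
  (0 < n)%nat ->
  poly_bounded (geom_coeff n) 0 /\ has_expansion (fun z => / (1 - z ^ n))%C (geom_coeff n).
Proof.
intros Hn.
assert (B : poly_bounded (geom_coeff n) 0).
{ intros k. unfold geom_coeff. destruct Nat.eq_dec; rewrite ?Cmod_1, ?Cmod_0; simpl; lra. }
split; [exact B|].
destruct (poly_bounded_has_expansion _ _ B) as [g Hg].
apply (has_expansion_ext g _ _ _ Hg); [|reflexivity].
intros z Hz. pose proof (disk_pow_neq_1 n z Hn Hz) as Hz1.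
assert (E : (g z - z ^ n * g z)%C = 1%C).
{ apply (has_expansion_unique (fun z => g z - z ^ n * g z)%C _ _ z) with (2 := has_expansion_1);
    [|exact Hz].
  apply (has_expansion_ext _ _ _ _ (has_expansion_minus _ _ _ _ Hg (has_expansion_shift_n n _ _ Hg)));
    [reflexivity|].
  intros k. rewrite iter_shift. unfold geom_coeff. destruct (lt_dec k n) as [L|L].
  - rewrite Nat.mod_small by exact L. destruct k; simpl; ring.
  - replace (k mod n) with ((k - n) mod n).
    + destruct k; [lia|]. destruct Nat.eq_dec; ring.
    + replace k with (k - n + 1 * n)%nat at 2 by lia. symmetry. apply Nat.Div0.mod_add. }
replace (g z) with ((g z - z ^ n * g z) / (1 - z ^ n))%C by (field; exact Hz1).
rewrite E. field. exact Hz1.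
Qed.

(** The Taylor remainder of w^(k+1) is of order r^(k-1) |w - z|^2; the factor r on the left avoids
    the exponent k - 1. The next remainder is w times the current one plus (k+1) z^k (w - z)^2, and
    i^2 + i <= (i + 1)^2 closes the induction. *)
Lemma Cpow_taylor_bound (r : R) (z w : C) (k : nat) :
  Cmod z <= r -> Cmod w <= r ->
  r * Cmod (w ^ S k - z ^ S k - INR (S k) * z ^ k * (w - z)) <=
  INR (S k) ^ 2 * Cmod (w - z) ^ 2 * r ^ k.
Proof.
intros Hz Hw. pose proof (Cmod_ge_0 z).
induction k as [|k IH].
- replace (w ^ 1 - z ^ 1 - INR 1 * z ^ 0 * (w - z))%C with (RtoC 0) by (simpl; ring).
  rewrite Cmod_0. pose proof (pow2_ge_0 (Cmod (w - z))). simpl in *. lra.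
- replace (w ^ S (S k) - z ^ S (S k) - INR (S (S k)) * z ^ S k * (w - z))%C with
    (w * (w ^ S k - z ^ S k - INR (S k) * z ^ k * (w - z)) + INR (S k) * z ^ k * (w - z) ^ 2)%C
    by (rewrite (S_INR (S k)), RtoC_plus; generalize (INR (S k)); intros c; simpl; ring).
  apply Rle_trans with (r * (Cmod w * Cmod (w ^ S k - z ^ S k - INR (S k) * z ^ k * (w - z))
    + INR (S k) * Cmod z ^ k * Cmod (w - z) ^ 2)).
  { apply Rmult_le_compat_l; [lra|]. apply Rle_trans with (1 := Cmod_triangle _ _).
    rewrite !Cmod_mult, !Cmod_pow, Cmod_R, (Rabs_pos_eq _ (pos_INR _)). lra. }
  set (E := Cmod (w ^ S k - z ^ S k - INR (S k) * z ^ k * (w - z))) in *.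
  assert (HE : 0 <= E) by apply Cmod_ge_0.
  assert (H1 : Cmod w * (r * E) <= r * (INR (S k) ^ 2 * Cmod (w - z) ^ 2 * r ^ k)).
  { apply Rmult_le_compat; [apply Cmod_ge_0 | nra | exact Hw | exact IH]. }
  assert (H2 : Cmod z ^ k <= r ^ k) by (apply pow_incr; lra).
  assert (H3 : 0 <= INR (S k)) by apply pos_INR.
  assert (H4 : 0 <= Cmod (w - z) ^ 2) by apply pow2_ge_0.
  assert (H5 : 0 <= r ^ k) by (apply pow_le; lra).
  assert (H6 : r * (INR (S k) * Cmod z ^ k * Cmod (w - z) ^ 2) <= r * (INR (S k) * r ^ k * Cmod (w - z) ^ 2)).
  { apply Rmult_le_compat_l; [lra|]. apply Rmult_le_compat_r; [easy|]. apply Rmult_le_compat_l; easy. }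
  rewrite (S_INR (S k)). change (r ^ S k) with (r * r ^ k).
  set (i := INR (S k)) in *. set (D := Cmod (w - z) ^ 2) in *. set (q := r ^ k) in *.
  assert (0 <= D * (r * q)) by (apply Rmult_le_pos; [easy | apply Rmult_le_pos; lra]).
  nra.
Qed.

(** Termwise differentiation: the remainder of [h] is the sum of the Taylor remainders of its
    monomials. On a disk of radius r < 1 they add up to at most [Series c] |w - z|^2 / r. *)
Lemma has_expansion_antiderivative (h phi : C -> C) (a b : nat -> C) (m : nat) (z : C) :
  poly_bounded b m -> has_expansion phi b -> has_expansion h a ->
  (forall k, b k = INR (S k) * a (S k))%C -> disk z -> is_Cderive h z (phi z).
Proof.
intros Hb Hphi Hh Hab Hz.
apply is_Cderive_eps. intros eps Heps.
unfold disk in Hz. pose proof (Cmod_ge_0 z) as Hz0.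
set (r := (1 + Cmod z) / 2).
set (c := fun k => INR (S k) ^ (m + 2) * r ^ k).
assert (Ec : ex_series c) by (apply ex_series_poly_geom; unfold r; lra).
assert (HM : 0 <= Series c).
{ rewrite <- (Rmult_0_l (Series c)), <- Series_scal_l.
  apply Series_le; [|exact Ec]. intros k. rewrite Rmult_0_l. split; [lra|].
  unfold c. apply Rmult_le_pos; apply pow_le; [apply pos_INR | unfold r; lra]. }
(* The first radius keeps w in the disk of radius r, the second makes the quadratic bound at most
   eps |w - z|; the 1 guards against a zero denominator. *)
exists (Rmin (r - Cmod z) (eps * r / (Series c + 1))). split.
{ apply Rmin_pos; [unfold r; lra|]. apply Rdiv_lt_0_compat; [|lra]. apply Rmult_lt_0_compat; [easy|unfold r; lra]. }
intros w Hw.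
assert (W1 : Cmod (w - z) < r - Cmod z) by (eapply Rlt_le_trans; [exact Hw | apply Rmin_l]).
assert (W2 : Cmod (w - z) < eps * r / (Series c + 1)) by (eapply Rlt_le_trans; [exact Hw | apply Rmin_r]).
assert (Hwr : Cmod w <= r).
{ replace w with (z + (w - z))%C by ring. pose proof (Cmod_triangle z (w - z)). lra. }
assert (Dz : disk z) by exact Hz.
assert (Dw : disk w) by (unfold disk; unfold r in Hwr; lra).
(* Dropping the constant term aligns u^(k+1) in the series of [h] with z^k in that of [phi]. *)
assert (Sh : forall u, disk u ->
  @is_series C_AbsRing C_NormedModule (fun k => u ^ S k * a (S k))%C (h u - a O)%C).
{ intros u Hu.
  apply (is_series_ext (fun k => @scal C_AbsRing C_NormedModule (@pow_n C_Ring u (S k)) (a (S k)))).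
  { intros k. reflexivity. }
  apply (@is_series_incr_1 C_AbsRing C_NormedModule (fun k => @scal C_AbsRing C_NormedModule (@pow_n C_Ring u k) (a k))).
  replace (plus _ _) with (h u); [exact (Hh u Hu)|].
  change (h u = (h u - a O) + 1 * a O)%C. ring. }
assert (T : @is_series C_AbsRing C_NormedModule
  (fun k => a (S k) * (w ^ S k - z ^ S k - INR (S k) * z ^ k * (w - z)))%C
  (h w - h z - phi z * (w - z))%C).
{ assert (P := @is_series_scal C_AbsRing C_NormedModule (w - z)%C _ _ (Hphi z Dz)).
  assert (Q := @is_series_minus C_AbsRing C_NormedModule _ _ _ _
    (@is_series_minus C_AbsRing C_NormedModule _ _ _ _ (Sh w Dw) (Sh z Dz)) P).
  replace (h w - h z - phi z * (w - z))%C with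
    ((h w - a O) - (h z - a O) - (w - z) * phi z)%C by ring.
  refine (is_series_ext _ _ _ _ Q).
  intros k.
  change ((w ^ S k * a (S k) - z ^ S k * a (S k) - (w - z) * (z ^ k * b k))
   = a (S k) * (w ^ S k - z ^ S k - INR (S k) * z ^ k * (w - z)))%C.
  rewrite Hab.
  generalize (INR (S k)) (w ^ S k)%C (z ^ S k)%C. intros. ring. }
assert (Bd : r * Cmod (h w - h z - phi z * (w - z)) <= Series c * Cmod (w - z) ^ 2).
{ assert (T' := @is_series_scal C_AbsRing C_NormedModule (RtoC r) _ _ T).
  replace (r * Cmod (h w - h z - phi z * (w - z))) with (Cmod (r * (h w - h z - phi z * (w - z)))%C)
    by (rewrite Cmod_mult, Cmod_R, Rabs_pos_eq; [reflexivity | unfold r; lra]).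
  rewrite <- Series_scal_r.
  apply (is_series_Cmod_le _ _ _ T'); [|apply ex_series_scal_r; exact Ec].
  intros k.
  change (Cmod (r * (a (S k) * (w ^ S k - z ^ S k - INR (S k) * z ^ k * (w - z))))%C <= c k * Cmod (w - z) ^ 2).
  rewrite !Cmod_mult, Cmod_R, Rabs_pos_eq by (unfold r; lra).
  set (E := Cmod (w ^ S k - z ^ S k - INR (S k) * z ^ k * (w - z))).
  assert (HE : r * E <= INR (S k) ^ 2 * Cmod (w - z) ^ 2 * r ^ k)
    by (apply Cpow_taylor_bound; [unfold r; lra | exact Hwr]).
  assert (HA : Cmod (a (S k)) <= INR (S k) ^ m).
  { apply Rle_trans with (2 := Hb k). rewrite Hab, Cmod_mult, Cmod_R, Rabs_pos_eq by apply pos_INR.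
    pose proof (Cmod_ge_0 (a (S k))). pose proof (pos_INR k). rewrite S_INR. nra. }
  unfold c. rewrite pow_add.
  replace (r * (Cmod (a (S k)) * E)) with (Cmod (a (S k)) * (r * E)) by ring.
  replace (INR (S k) ^ m * INR (S k) ^ 2 * r ^ k * Cmod (w - z) ^ 2)
    with (INR (S k) ^ m * (INR (S k) ^ 2 * Cmod (w - z) ^ 2 * r ^ k)) by ring.
  apply Rmult_le_compat; [apply Cmod_ge_0 | | exact HA | exact HE].
  apply Rmult_le_pos; [unfold r; lra | apply Cmod_ge_0]. }
apply Rmult_le_reg_l with r; [unfold r; lra|].
apply Rle_trans with (1 := Bd).
pose proof (Cmod_ge_0 (w - z)) as D0.
apply Rmult_lt_compat_r with (r := Series c + 1) in W2; [|lra].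
replace (eps * r / (Series c + 1) * (Series c + 1)) with (eps * r) in W2 by (field; lra).
simpl. nra.
Qed.

(** * Harmonic mappings h + conj g *)

Definition holomorphic_on_disk (phi phi1 : C -> C) : Prop :=
  forall z : C, disk z -> is_Cderive phi z (phi1 z).

Lemma is_Cderive_ext_disk (f g : C -> C) (z l : C) :
  (forall w, disk w -> f w = g w) -> disk z -> is_Cderive f z l -> is_Cderive g z l.
Proof.
intros E Hz. apply (is_derive_ext_loc (K := C_AbsRing) (V := C_NormedModule)).
apply locally_C. apply (filter_imp disk); [exact E | apply locally_disk, Hz].
Qed.

Lemma is_derive_x_of_Re (u : C -> R) (phi phi1 : C -> C) (z : C) :
  (forall w, disk w -> u w = Re (phi w)) -> holomorphic_on_disk phi phi1 -> disk z ->
  is_derive (fun x : R => u (x, Im z)) (Re z) (Re (phi1 z)).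
Proof.
intros Hu Hphi Hz.
apply (is_derive_ext_loc (fun x : R => Re (phi (x, Im z)))).
- destruct (locally_disk z Hz) as [d Hd]. exists d. intros x Hx.
  symmetry. apply Hu, Hd. split; [exact Hx | apply ball_center].
- apply is_derive_Re_x, Hphi, Hz.
Qed.

Lemma is_derive_y_of_Re (u : C -> R) (phi phi1 : C -> C) (z : C) :
  (forall w, disk w -> u w = Re (phi w)) -> holomorphic_on_disk phi phi1 -> disk z ->
  is_derive (fun y : R => u (Re z, y)) (Im z) (Re (Ci * phi1 z)%C).
Proof.
intros Hu Hphi Hz.
apply (is_derive_ext_loc (fun y : R => Re (phi (Re z, y)))).
- destruct (locally_disk z Hz) as [d Hd]. exists d. intros y Hy.
  symmetry. apply Hu, Hd. split; [apply ball_center | exact Hy].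
- apply is_derive_Re_y, Hphi, Hz.
Qed.

Lemma Dx_of_Re (u : C -> R) (phi phi1 : C -> C) (z : C) :
  (forall w, disk w -> u w = Re (phi w)) -> holomorphic_on_disk phi phi1 -> disk z ->
  Defs.Dx u z = Re (phi1 z).
Proof.
intros Hu Hphi Hz. apply is_derive_unique. eapply is_derive_x_of_Re; eassumption.
Qed.

Lemma Dy_of_Re (u : C -> R) (phi phi1 : C -> C) (z : C) :
  (forall w, disk w -> u w = Re (phi w)) -> holomorphic_on_disk phi phi1 -> disk z ->
  Dy u z = Re (Ci * phi1 z)%C.
Proof.
intros Hu Hphi Hz. apply is_derive_unique. eapply is_derive_y_of_Re; eassumption.
Qed.

Definition continuous_on_disk (phi : C -> C) : Prop :=
  forall z : C, disk z -> @continuous C_UniformSpace C_UniformSpace phi z.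

Lemma continuous_C_iff (U : UniformSpace) (f : U -> C) (x : U) :
  @continuous U C_UniformSpace f x <-> @continuous U (AbsRing_UniformSpace C_AbsRing) f x.
Proof. split; intros H P HP; apply H, locally_C, HP. Qed.

Lemma continuous_Cmult (f g : C -> C) (z : C) :
  @continuous C_UniformSpace C_UniformSpace f z ->
  @continuous C_UniformSpace C_UniformSpace g z ->
  @continuous C_UniformSpace C_UniformSpace (fun w => f w * g w)%C z.
Proof.
rewrite !continuous_C_iff. apply (@continuous_mult C_UniformSpace C_AbsRing f g).
Qed.

Lemma continuous_Re_scal (c : C) (phi : C -> C) (z : C) :
  @continuous C_UniformSpace C_UniformSpace phi z ->
  @continuous C_UniformSpace R_UniformSpace (fun w => Re (c * phi w)%C) z.
Proof.
intros H.
apply (@continuous_minus C_UniformSpace R_AbsRing R_NormedModule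
  (fun w => Re c * Re (phi w)) (fun w => Im c * Im (phi w)));
apply (@continuous_scal C_UniformSpace R_AbsRing R_NormedModule); try apply continuous_const.
- apply (@continuous_comp C_UniformSpace C_UniformSpace R_UniformSpace phi Re); [exact H|].
  apply (@continuous_fst R_UniformSpace R_UniformSpace).
- apply (@continuous_comp C_UniformSpace C_UniformSpace R_UniformSpace phi Im); [exact H|].
  apply (@continuous_snd R_UniformSpace R_UniformSpace).
Qed.

Lemma C1_on_disk_of_Re (u : C -> R) (phi phi1 : C -> C) :
  (forall w, disk w -> u w = Re (phi w)) -> holomorphic_on_disk phi phi1 ->
  continuous_on_disk phi1 -> C1_on_disk u.
Proof.
intros Hu Hphi Hc z Hz. repeat split.
- eexists. eapply is_derive_x_of_Re; eassumption.
- eexists. eapply is_derive_y_of_Re; eassumption.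
- apply continuous_ext_loc with (fun w => Re (1 * phi1 w)%C).
  + apply (filter_imp disk); [|apply locally_disk, Hz]. intros w Hw.
    rewrite Cmult_1_l. symmetry. eapply Dx_of_Re; eassumption.
  + apply continuous_Re_scal, Hc, Hz.
- apply continuous_ext_loc with (fun w => Re (Ci * phi1 w)%C).
  + apply (filter_imp disk); [|apply locally_disk, Hz]. intros w Hw.
    symmetry. eapply Dy_of_Re; eassumption.
  + apply continuous_Re_scal, Hc, Hz.
Qed.

Lemma holomorphic_on_disk_scal (c : C) (phi phi1 : C -> C) :
  holomorphic_on_disk phi phi1 ->
  holomorphic_on_disk (fun z => c * phi z)%C (fun z => c * phi1 z)%C.
Proof. intros H z Hz. apply is_Cderive_scal, H, Hz. Qed.

Lemma holomorphic_continuous_on_disk (phi phi1 : C -> C) :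
  holomorphic_on_disk phi phi1 -> continuous_on_disk phi.
Proof. intros H z Hz. eapply is_Cderive_continuous, H, Hz. Qed.

(** The partial derivatives of Re phi are Re phi' and Re (i phi'), again real parts of holomorphic
    functions, so [C1_on_disk_of_Re] applies to all three. Laplace's equation is then 1 + i^2 =
    0. *)
Lemma real_harmonic_of_Re (u : C -> R) (phi phi1 phi2 : C -> C) :
  (forall w, disk w -> u w = Re (phi w)) -> holomorphic_on_disk phi phi1 ->
  holomorphic_on_disk phi1 phi2 -> continuous_on_disk phi2 -> real_harmonic u.
Proof.
intros Hu H1 H2 Hc.
assert (H2' := holomorphic_on_disk_scal Ci _ _ H2).
assert (Hx : forall w, disk w -> Defs.Dx u w = Re (phi1 w)) by (intros; eapply Dx_of_Re; eassumption).
assert (Hy : forall w, disk w -> Dy u w = Re (Ci * phi1 w)%C) by (intros; eapply Dy_of_Re; eassumption).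
assert (Hc' : continuous_on_disk (fun z => Ci * phi2 z)%C).
{ intros z Hz. apply continuous_Cmult; [apply continuous_const | exact (Hc z Hz)]. }
split; [|split; [|split]].
- apply (C1_on_disk_of_Re u phi phi1); auto. eapply holomorphic_continuous_on_disk; eassumption.
- apply (C1_on_disk_of_Re _ phi1 phi2); auto.
- apply (C1_on_disk_of_Re _ _ _ Hy H2' Hc').
- intros z Hz.
  rewrite (Dx_of_Re _ _ _ z Hx H2 Hz), (Dy_of_Re _ _ _ z Hy H2' Hz).
  unfold Re, Im. simpl. ring.
Qed.

Lemma re_part_canonical (f h g : C -> C) :
  (forall z, disk z -> f z = (h z + Cconj (g z))%C) ->
  forall z, disk z -> re_part f z = Re (h z + g z)%C.
Proof. intros H z Hz. unfold re_part. rewrite (H z Hz). reflexivity. Qed.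

(** Conjugation turns + into - in the imaginary part, and the factor -i presents it as a real part,
    so the lemmas on Re phi cover Im f too. *)
Lemma im_part_canonical (f h g : C -> C) :
  (forall z, disk z -> f z = (h z + Cconj (g z))%C) ->
  forall z, disk z -> im_part f z = Re (- Ci * (h z - g z))%C.
Proof.
intros H z Hz. unfold im_part. rewrite (H z Hz). unfold Re, Im. simpl. ring.
Qed.

Lemma holomorphic_on_disk_plus (h g h1 g1 : C -> C) :
  holomorphic_on_disk h h1 -> holomorphic_on_disk g g1 ->
  holomorphic_on_disk (fun z => h z + g z)%C (fun z => h1 z + g1 z)%C.
Proof. intros Hh Hg z Hz. apply is_Cderive_plus; auto. Qed.

Lemma holomorphic_on_disk_minus (h g h1 g1 : C -> C) :
  holomorphic_on_disk h h1 -> holomorphic_on_disk g g1 ->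
  holomorphic_on_disk (fun z => h z - g z)%C (fun z => h1 z - g1 z)%C.
Proof. intros Hh Hg z Hz. apply is_Cderive_minus; auto. Qed.

Lemma canonical_partials (f h g h1 g1 : C -> C) (z : C) :
  (forall z, disk z -> f z = (h z + Cconj (g z))%C) ->
  holomorphic_on_disk h h1 -> holomorphic_on_disk g g1 -> disk z ->
  Defs.Dx (re_part f) z = Re (h1 z + g1 z)%C /\ Dy (re_part f) z = - Im (h1 z + g1 z)%C /\
  Defs.Dx (im_part f) z = Im (h1 z - g1 z)%C /\ Dy (im_part f) z = Re (h1 z - g1 z)%C.
Proof.
intros Hf Hh Hg Hz.
pose proof (re_part_canonical f h g Hf) as Hr.
pose proof (im_part_canonical f h g Hf) as Hi.
pose proof (holomorphic_on_disk_plus _ _ _ _ Hh Hg) as Hp.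
pose proof (holomorphic_on_disk_scal (- Ci) _ _ (holomorphic_on_disk_minus _ _ _ _ Hh Hg)) as Hm.
rewrite (Dx_of_Re _ _ _ z Hr Hp Hz), (Dy_of_Re _ _ _ z Hr Hp Hz),
  (Dx_of_Re _ _ _ z Hi Hm Hz), (Dy_of_Re _ _ _ z Hi Hm Hz).
unfold Re, Im. simpl. repeat split; ring.
Qed.

Lemma jacobian_canonical (f h g h1 g1 : C -> C) (z : C) :
  (forall z, disk z -> f z = (h z + Cconj (g z))%C) ->
  holomorphic_on_disk h h1 -> holomorphic_on_disk g g1 -> disk z ->
  jacobian f z = Cmod (h1 z) ^ 2 - Cmod (g1 z) ^ 2.
Proof.
intros Hf Hh Hg Hz. unfold jacobian.
destruct (canonical_partials f h g h1 g1 z Hf Hh Hg Hz) as (-> & -> & -> & ->).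
rewrite !Cmod2_alt. unfold Re, Im. simpl. ring.
Qed.

Lemma Dz_canonical (f h g h1 g1 : C -> C) (z : C) :
  (forall z, disk z -> f z = (h z + Cconj (g z))%C) ->
  holomorphic_on_disk h h1 -> holomorphic_on_disk g g1 -> disk z ->
  Dz f z = h1 z.
Proof.
intros Hf Hh Hg Hz. unfold Dz.
destruct (canonical_partials f h g h1 g1 z Hf Hh Hg Hz) as (-> & -> & -> & ->).
apply injective_projections; unfold Re, Im; simpl; field.
Qed.

Lemma Dzbar_canonical (f h g h1 g1 : C -> C) (z : C) :
  (forall z, disk z -> f z = (h z + Cconj (g z))%C) ->
  holomorphic_on_disk h h1 -> holomorphic_on_disk g g1 -> disk z ->
  Dzbar f z = Cconj (g1 z).
Proof.
intros Hf Hh Hg Hz. unfold Dzbar.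
destruct (canonical_partials f h g h1 g1 z Hf Hh Hg Hz) as (-> & -> & -> & ->).
apply injective_projections; unfold Re, Im; simpl; field.
Qed.

Lemma harmonic_canonical (f h g h1 g1 h2 g2 : C -> C) :
  (forall z, disk z -> f z = (h z + Cconj (g z))%C) ->
  holomorphic_on_disk h h1 -> holomorphic_on_disk g g1 ->
  holomorphic_on_disk h1 h2 -> holomorphic_on_disk g1 g2 ->
  continuous_on_disk (fun z => h2 z + g2 z)%C ->
  continuous_on_disk (fun z => - Ci * (h2 z - g2 z))%C ->
  harmonic f.
Proof.
intros Hf Hh Hg Hh1 Hg1 Cp Cm. split.
- exact (real_harmonic_of_Re _ _ _ _ (re_part_canonical f h g Hf)
    (holomorphic_on_disk_plus _ _ _ _ Hh Hg) (holomorphic_on_disk_plus _ _ _ _ Hh1 Hg1) Cp).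
- exact (real_harmonic_of_Re _ _ _ _ (im_part_canonical f h g Hf)
    (holomorphic_on_disk_scal (- Ci) _ _ (holomorphic_on_disk_minus _ _ _ _ Hh Hg))
    (holomorphic_on_disk_scal (- Ci) _ _ (holomorphic_on_disk_minus _ _ _ _ Hh1 Hg1)) Cm).
Qed.

(** * The functions z / (1 - z) and 1 / ((1 - z)^2 (1 - z^n)) *)

(** By the mean value theorem V grows at least at rate m. This gives injectivity, and also
    unboundedness in both directions, so the intermediate value theorem reaches every y. *)
Lemma increasing_bijective (V V' : R -> R) (m : R) :
  0 < m -> (forall t, is_derive V t (V' t)) -> (forall t, m <= V' t) ->
  (forall s t, V s = V t -> s = t) /\ (forall y, exists t, V t = y).
Proof.
intros Hm HV Hm'.
assert (Cont : continuity V).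
{ intros t. apply continuity_pt_filterlim.
  apply (@ex_derive_continuous R_AbsRing R_NormedModule). eexists. apply HV. }
assert (Incr : forall s t, s <= t -> m * (t - s) <= V t - V s).
{ intros s t Hst. destruct (MVT_gen V s t V') as [x [_ E]].
  - intros; apply HV.
  - intros; apply Cont.
  - rewrite E. apply Rmult_le_compat_r; [lra | apply Hm']. }
split.
- intros s t E. destruct (Rtotal_order s t) as [L|[L|L]]; [|exact L|].
  + pose proof (Incr s t ltac:(lra)). nra.
  + pose proof (Incr t s ltac:(lra)). nra.
(* Growth at rate m from V 0 gives V (-T) <= y <= V T. *)
- intros y. set (T := Rabs (y - V 0) / m).
  assert (HT : 0 <= T) by (apply Rdiv_le_0_compat; [apply Rabs_pos | exact Hm]).
  assert (ET : m * T = Rabs (y - V 0)) by (unfold T; field; lra).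
  pose proof (Incr 0 T ltac:(lra)). pose proof (Incr (- T) 0 ltac:(lra)).
  pose proof (Rle_abs (y - V 0)). pose proof (Rle_abs (- (y - V 0))) as Q. rewrite Rabs_Ropp in Q.
  destruct (IVT_gen V (- T) T y Cont) as [t [_ Ht]]; [|exists t; exact Ht].
  rewrite Rmin_left, Rmax_right by nra. nra.
Qed.

(** * The disk and the half-plane under w = z / (1 - z) *)

Lemma Cmod_sqr (z : C) : Cmod z ^ 2 = Re z * Re z + Im z * Im z.
Proof. rewrite Cmod2_alt. ring. Qed.

Lemma disk_sqr (z : C) : disk z <-> Re z * Re z + Im z * Im z < 1.
Proof.
rewrite <- Cmod_sqr. unfold disk. pose proof (Cmod_ge_0 z). simpl. split; intros; nra.
Qed.

Lemma half_plane_neq (w : C) : - / 2 < Re w -> (1 + w)%C <> 0%C.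
Proof.
intros Hw E. apply (f_equal Re) in E. unfold Re in *. simpl in E. lra.
Qed.

(** Because |1 + w|^2 - |w|^2 = 1 + 2 Re w. *)
Lemma half_plane_disk (w : C) : - / 2 < Re w -> disk (w / (1 + w)).
Proof.
intros Hw. pose proof (half_plane_neq w Hw) as Hn.
unfold disk. rewrite Cmod_div by exact Hn.
pose proof (proj1 (Cmod_gt_0 _) Hn) as Hp.
apply Rmult_lt_reg_r with (Cmod (1 + w)); [exact Hp|].
unfold Rdiv. rewrite Rmult_assoc, Rinv_l by lra.
pose proof (Cmod_ge_0 w).
pose proof (Cmod_sqr w) as E1. pose proof (Cmod_sqr (1 + w)) as E2.
unfold Re, Im in *. simpl in E1, E2. nra.
Qed.

Lemma disk_half_plane (z : C) : disk z -> - / 2 < Re (z / (1 - z))%C.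
Proof.
intros Hz. pose proof (disk_neq_1 z Hz) as Hn.
pose proof (proj1 (Cmod_gt_0 _) Hn) as Hp.
pose proof (Cmod_sqr (1 - z)) as E. apply disk_sqr in Hz.
assert (P : 0 < Cmod (1 - z) ^ 2) by (apply pow_lt; exact Hp).
rewrite E in P. destruct z as [x y]. unfold Re, Im in *. simpl in *.
set (d := (1 + - x) * (1 + - x) + (0 + - y) * (0 + - y)) in *.
match goal with |- _ < ?e => replace e with ((x * (1 - x) - y * y) / d) end.
- apply Rmult_lt_reg_r with d; [exact P|]. unfold Rdiv at 1.
  rewrite Rmult_assoc, Rinv_l by lra. unfold d. nra.
- unfold d in *. field. nra.
Qed.

Lemma Cmod_one_minus_pow_le (n : nat) (z : C) :
  disk z -> Cmod (1 - z ^ n) <= INR n * Cmod (1 - z).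
Proof.
intros Hz. induction n as [|n IH].
- replace (1 - z ^ 0)%C with (RtoC 0) by (simpl; ring). rewrite Cmod_0. simpl. lra.
- replace (1 - z ^ S n)%C with ((1 - z) + z * (1 - z ^ n))%C by (simpl; ring).
  rewrite S_INR. apply Rle_trans with (1 := Cmod_triangle _ _). rewrite Cmod_mult.
  unfold disk in Hz. pose proof (Cmod_ge_0 (1 - z ^ n)). pose proof (Cmod_ge_0 z). nra.
Qed.

Lemma Re_cayley (u : C) : (1 - u)%C <> 0%C ->
  Re ((1 + u) / (1 - u))%C = (1 - Cmod u ^ 2) / Cmod (1 - u) ^ 2.
Proof.
intros H. apply Cmod_gt_0 in H. pose proof (pow_lt _ 2 H) as P.
rewrite !Cmod_sqr in *. destruct u as [x y]. unfold Re, Im in *. simpl in *. field. nra.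
Qed.

(* Harnack-type bound: |1 - z^n| <= n |1 - z| compares the Poisson kernels at z^n and z. *)
Lemma Re_cayley_pow_ge (n : nat) (z : C) : (0 < n)%nat -> disk z ->
  Re ((1 + z) / (1 - z))%C / INR n ^ 2 <= Re ((1 + z ^ n) / (1 - z ^ n))%C.
Proof.
intros Hn Hz.
pose proof (disk_neq_1 z Hz) as H1. pose proof (disk_pow_neq_1 n z Hn Hz) as Hn1.
rewrite !Re_cayley by assumption.
apply Cmod_gt_0 in H1. apply Cmod_gt_0 in Hn1.
pose proof (Cmod_one_minus_pow_le n z Hz) as L.
assert (Hi : 0 < INR n) by (apply lt_0_INR; exact Hn).
assert (L2 : Cmod (1 - z ^ n) ^ 2 <= (INR n * Cmod (1 - z)) ^ 2) by (apply pow_incr; lra).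
pose proof (pow_lt _ 2 Hn1).
unfold disk in Hz. pose proof (Cmod_ge_0 z).
assert (L3 : Cmod (z ^ n) <= Cmod z).
{ rewrite Cmod_pow. destruct n as [|n]; [lia|]. simpl.
  assert (Cmod z ^ n <= 1) by (rewrite <- (pow1 n); apply pow_incr; lra). nra. }
pose proof (Cmod_ge_0 (z ^ n)).
replace ((1 - Cmod z ^ 2) / Cmod (1 - z) ^ 2 / INR n ^ 2)
  with ((1 - Cmod z ^ 2) / (INR n * Cmod (1 - z)) ^ 2) by (field; lra).
apply Rmult_le_compat.
- simpl. nra.
- apply Rlt_le, Rinv_0_lt_compat, pow_lt, Rmult_lt_0_compat; assumption.
- simpl. nra.
- apply Rinv_le_contravar; assumption.
Qed.

(** * The derivative h' and its antiderivative *)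

Definition hprime (n : nat) (z : C) : C := (/ ((1 - z) ^ 2 * (1 - z ^ n)))%C.

(** Given in closed form so that the continuity of second partial derivatives demanded by
    [C1_on_disk] can be read off. *)
Definition hsecond (n : nat) (z : C) : C :=
  (2 * / (1 - z) ^ 3 * / (1 - z ^ n)
   + INR n * z ^ pred n * / (1 - z) ^ 2 * / (1 - z ^ n) ^ 2)%C.

Lemma holomorphic_geom : holomorphic_on_disk (fun z => z / (1 - z))%C (fun z => / (1 - z) ^ 2)%C.
Proof.
intros z Hz. pose proof (disk_neq_1 z Hz) as H. eapply is_Cderive_eq.
- apply (is_Cderive_mult (fun z => z) (fun z => / (1 - z))%C); [apply is_Cderive_id|].
  apply (is_Cderive_inv (fun z => 1 - z)%C); [|exact H].
  apply is_Cderive_minus; [apply is_Cderive_const | apply is_Cderive_id].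
- cbv beta. field. exact H.
Qed.

Lemma holomorphic_inv_one_minus (k : nat) :
  holomorphic_on_disk (fun z => / (1 - z) ^ k)%C (fun z => INR k * / (1 - z) ^ S k)%C.
Proof.
intros z Hz. pose proof (disk_neq_1 z Hz) as H. eapply is_Cderive_eq.
- apply (is_Cderive_inv (fun z => (1 - z) ^ k)%C); [|apply Cpow_nz; exact H].
  apply (is_Cderive_comp (fun u => u ^ k)%C (fun z => 1 - z)%C); [apply is_Cderive_pow|].
  apply is_Cderive_minus; [apply is_Cderive_const | apply is_Cderive_id].
- destruct k as [|k]; cbv beta.
  + simpl. field. exact H.
  + generalize (INR (S k)). intros c. simpl. field.
    split; [|exact H]. apply Cpow_nz; exact H.
Qed.

Lemma holomorphic_inv_one_minus_pow (n : nat) : (0 < n)%nat ->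
  holomorphic_on_disk (fun z => / (1 - z ^ n))%C
    (fun z => INR n * z ^ pred n * / (1 - z ^ n) ^ 2)%C.
Proof.
intros Hn z Hz. pose proof (disk_pow_neq_1 n z Hn Hz) as H. eapply is_Cderive_eq.
- apply (is_Cderive_inv (fun z => 1 - z ^ n)%C); [|exact H].
  apply is_Cderive_minus; [apply is_Cderive_const | apply is_Cderive_pow].
- cbv beta. field. exact H.
Qed.

Lemma holomorphic_hprime (n : nat) : (0 < n)%nat -> holomorphic_on_disk (hprime n) (hsecond n).
Proof.
intros Hn z Hz.
pose proof (disk_neq_1 z Hz) as H. pose proof (disk_pow_neq_1 n z Hn Hz) as H'.
apply (is_Cderive_ext_disk (fun z => / (1 - z) ^ 2 * / (1 - z ^ n))%C); [|exact Hz|].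
{ intros w Hw. unfold hprime. pose proof (disk_neq_1 w Hw). pose proof (disk_pow_neq_1 n w Hn Hw).
  field. split; assumption. }
eapply is_Cderive_eq.
- apply is_Cderive_mult; [apply (holomorphic_inv_one_minus 2 z Hz) |
    apply (holomorphic_inv_one_minus_pow n Hn z Hz)].
- unfold hsecond. change (INR 2) with (1 + 1). rewrite RtoC_plus.
  generalize (INR n). intros c. field. split; assumption.
Qed.

Lemma continuous_hsecond (n : nat) : (0 < n)%nat -> continuous_on_disk (hsecond n).
Proof.
intros Hn z Hz.
assert (A : forall k, @continuous C_UniformSpace C_UniformSpace (fun z => / (1 - z) ^ k)%C z).
{ intros k. eapply holomorphic_continuous_on_disk; [apply holomorphic_inv_one_minus | exact Hz]. }
assert (B : @continuous C_UniformSpace C_UniformSpace (fun z => / (1 - z ^ n))%C z).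
{ eapply holomorphic_continuous_on_disk; [apply holomorphic_inv_one_minus_pow, Hn | exact Hz]. }
apply continuous_C_iff.
apply (@continuous_plus C_UniformSpace C_AbsRing (AbsRing_NormedModule C_AbsRing)
  (fun z => 2 * / (1 - z) ^ 3 * / (1 - z ^ n))%C); apply continuous_C_iff.
- apply (continuous_Cmult (fun z => 2 * / (1 - z) ^ 3)%C); [|exact B].
  apply (continuous_Cmult (fun _ => RtoC 2)); [apply continuous_const | apply A].
- apply continuous_ext_loc with
    (fun z => INR n * z ^ pred n * / (1 - z) ^ 2 * (/ (1 - z ^ n) * / (1 - z ^ n)))%C.
  { apply (filter_imp disk); [|apply locally_disk, Hz]. intros w Hw.
    pose proof (disk_neq_1 w Hw). pose proof (disk_pow_neq_1 n w Hn Hw).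
    match goal with |- ?a = ?b => change (@eq C a b) end.
    simpl. field. split; assumption. }
  apply (continuous_Cmult (fun z => INR n * z ^ pred n * / (1 - z) ^ 2)%C).
  + apply (continuous_Cmult (fun z => INR n * z ^ pred n)%C); [|apply A].
    apply (continuous_Cmult (fun _ => RtoC (INR n))); [apply continuous_const|].
    eapply is_Cderive_continuous, is_Cderive_pow.
  + apply continuous_Cmult; exact B.
Qed.

(** Two partial summations of the geometric series divide it twice by 1 - z and give h'; integrating
    coefficientwise gives h together with its coefficients. The expansion of z h' is recorded
    because the convolution with [f0] involves it. *)
Lemma exists_antiderivative_hprime (n : nat) : (0 < n)%nat ->
  exists (h : C -> C) (a : nat -> C),
    has_expansion h a /\ a O = 0%C /\ holomorphic_on_disk h (hprime n) /\
    has_expansion (fun z => z * hprime n z)%C (fun k => INR k * a k)%C.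
Proof.
intros Hn.
destruct (has_expansion_geom n Hn) as [B0 E0].
destruct (has_expansion_partial_sums _ _ _ B0 E0) as [B1 E1].
destruct (has_expansion_partial_sums _ _ _ B1 E1) as [B2 E2].
set (b := @sum_n C_AbelianMonoid (@sum_n C_AbelianMonoid (geom_coeff n))) in *.
assert (E : has_expansion (hprime n) b).
{ apply (has_expansion_ext _ _ _ _ E2); [|reflexivity]. intros z Hz.
  pose proof (disk_neq_1 z Hz). pose proof (disk_pow_neq_1 n z Hn Hz).
  unfold hprime. field. split; assumption. }
set (a := fun k => match k with O => RtoC 0 | S k => (b k / INR (S k))%C end).
assert (Hab : forall k, b k = (INR (S k) * a (S k))%C).
{ intros k. unfold a. change (@eq C (b k) (INR (S k) * (b k / INR (S k)))%C). generalize (b k : C). intros c.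
  field. intros H. apply RtoC_inj in H. revert H. apply not_0_INR. lia. }
destruct (poly_bounded_has_expansion a 2) as [h Hh].
{ intros [|k].
  - unfold a. rewrite Cmod_0. simpl. lra.
  - apply Rle_trans with (INR (S k) ^ 2).
    + apply Rle_trans with (2 := B2 k). rewrite Hab, Cmod_mult, Cmod_R, Rabs_pos_eq by apply pos_INR.
      pose proof (Cmod_ge_0 (a (S k))). pose proof (pos_INR k). rewrite S_INR. nra.
    + apply pow_incr. split; [apply pos_INR | apply le_INR; lia]. }
exists h, a. split; [exact Hh|]. split; [reflexivity|]. split.
- intros z Hz. exact (has_expansion_antiderivative h _ a b 2 z B2 E Hh Hab Hz).
- apply (has_expansion_ext _ _ _ _ (has_expansion_shift _ _ E)); [reflexivity|].
  intros [|k]; [simpl; ring | exact (Hab k)].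
Qed.

(** * The shear and its image *)

Lemma geom_half_plane_inverse (w : C) : - / 2 < Re w ->
  (w / (1 + w) / (1 - w / (1 + w)) = w)%C.
Proof.
intros Hw. pose proof (half_plane_neq w Hw) as H. field. split; [exact H|].
replace (1 + w - w)%C with (RtoC 1) by ring. intros E. apply RtoC_inj in E. lra.
Qed.

Lemma geom_inverse (z : C) : disk z ->
  (z / (1 - z) / (1 + z / (1 - z)) = z)%C.
Proof.
intros Hz. pose proof (disk_neq_1 z Hz) as H. field. split; [exact H|].
replace (1 - z + z)%C with (RtoC 1) by ring. intros E. apply RtoC_inj in E. lra.
Qed.

(** The factor 1/(1 - z)^2 of psi' is dw/dz and cancels under the substitution. Along the line Re
    ((1 + z)/(1 - z)) = 1 + 2 Re w keeps the value 1 + 2c, which makes the Harnack-type bound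
    uniform. *)
Lemma shear_line (n : nat) (psi : C -> C) (c : R) :
  (0 < n)%nat ->
  holomorphic_on_disk psi (fun z => hprime n z * (1 + z ^ n))%C -> - / 2 < c ->
  (forall s t : R, Im (psi ((c, s) / (1 + (c, s)))%C) = Im (psi ((c, t) / (1 + (c, t)))%C) -> s = t) /\
  (forall y : R, exists t : R, Im (psi ((c, t) / (1 + (c, t)))%C) = y).
Proof.
intros Hn Hpsi Hc.
assert (Hi : 0 < INR n) by (apply lt_0_INR; exact Hn).
apply (increasing_bijective _
  (fun t => let z := ((c, t) / (1 + (c, t)))%C in Re ((1 + z ^ n) / (1 - z ^ n))%C)
  ((1 + 2 * c) / INR n ^ 2)).
- apply Rdiv_lt_0_compat; [lra | apply pow_lt, Hi].
- intros t. set (w := ((c, t) : C)). set (z := (w / (1 + w))%C).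
  assert (Hw : - / 2 < Re w) by exact Hc.
  pose proof (half_plane_neq w Hw) as Hw1.
  pose proof (half_plane_disk w Hw) as Hz. fold z in Hz.
  pose proof (disk_neq_1 z Hz) as Hz1. pose proof (disk_pow_neq_1 n z Hn Hz) as Hzn.
  (* The factor -i reads Im psi as a real part; it cancels against the i contributed by the vertical
     direction. *)
  assert (D : is_Cderive (fun w => - Ci * psi (w / (1 + w)))%C w
    (- Ci * ((1 + z ^ n) / (1 - z ^ n)))%C).
  { apply is_Cderive_scal. eapply is_Cderive_eq.
    - apply (is_Cderive_comp psi (fun w => w / (1 + w))%C).
      + exact (Hpsi z Hz).
      + apply (is_Cderive_mult (fun w => w) (fun w => / (1 + w))%C); [apply is_Cderive_id|].
        apply (is_Cderive_inv (fun w => 1 + w)%C); [|exact Hw1].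
        apply is_Cderive_plus; [apply is_Cderive_const | apply is_Cderive_id].
    - cbv beta. unfold hprime.
      replace (1 - z)%C with (/ (1 + w))%C.
      + field. split; [exact Hzn | exact Hw1].
      + unfold z. field. exact Hw1. }
  apply is_derive_Re_y in D.
  replace (Re _) with (Re (Ci * (- Ci * ((1 + z ^ n) / (1 - z ^ n))))%C).
  + refine (is_derive_ext _ _ _ _ _ D). intros s.
    change (Re w) with c. generalize (psi ((c, s) / (1 + (c, s)))%C). intros p.
    unfold Re, Im. simpl. ring.
  + change (Re (Ci * (- Ci * ((1 + z ^ n) / (1 - z ^ n))))%C = Re ((1 + z ^ n) / (1 - z ^ n))%C).
    generalize ((1 + z ^ n) / (1 - z ^ n))%C. intros p. unfold Re, Im. simpl. ring.
- intros t. cbv zeta. set (w := ((c, t) : C)). set (z := (w / (1 + w))%C).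
  assert (Hw : - / 2 < Re w) by exact Hc.
  pose proof (half_plane_neq w Hw) as Hw1.
  pose proof (half_plane_disk w Hw) as Hz. fold z in Hz.
  apply Rle_trans with (2 := Re_cayley_pow_ge n z Hn Hz). right. f_equal.
  replace ((1 + z) / (1 - z))%C with (1 + 2 * w)%C.
  + unfold Re. simpl. ring.
  + pose proof (geom_half_plane_inverse w Hw) as G. fold z in G.
    pose proof (disk_neq_1 z Hz) as Hz1.
    rewrite <- G. field. exact Hz1.
Qed.

Lemma open_half_plane (c : R) : @open C_UniformSpace (fun w : C => c < Re w).
Proof.
intros w Hw. assert (Hd : 0 < Re w - c) by lra. exists (mkposreal _ Hd).
intros v [Hv _]. unfold ball in Hv. simpl in Hv. unfold AbsRing_ball, abs, minus, plus, opp in Hv.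
simpl in Hv. apply Rabs_def2 in Hv. unfold Re in *. lra.
Qed.

Lemma shear_K_HO (n : nat) (f h : C -> C) :
  (0 < n)%nat -> holomorphic_on_disk h (hprime n) -> h 0%C = 0%C ->
  (forall z, f z = h z + Cconj (z / (1 - z) - h z))%C ->
  K_HO f.
Proof.
intros Hn Hh Hh0 Hf.
set (g := fun z => (z / (1 - z) - h z)%C).
set (g1 := fun z => (- z ^ n * hprime n z)%C).
assert (Hf' : forall z, disk z -> f z = (h z + Cconj (g z))%C) by (intros; apply Hf).
assert (Hg1 : forall z, disk z -> (/ (1 - z) ^ 2 - hprime n z = g1 z)%C).
{ intros z Hz. unfold g1, hprime.
  pose proof (disk_neq_1 z Hz). pose proof (disk_pow_neq_1 n z Hn Hz). field. split; assumption. }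
assert (Hg : holomorphic_on_disk g g1).
{ intros z Hz. rewrite <- (Hg1 z Hz). exact (holomorphic_on_disk_minus _ _ _ _ holomorphic_geom Hh z Hz). }
set (g2 := fun z => (2 * / (1 - z) ^ 3 - hsecond n z)%C).
assert (Hh2 := holomorphic_hprime n Hn).
assert (Hg2 : holomorphic_on_disk g1 g2).
{ intros z Hz. apply (is_Cderive_ext_disk _ _ _ _ Hg1 Hz).
  replace (g2 z) with (INR 2 * / (1 - z) ^ 3 - hsecond n z)%C
    by (unfold g2; simpl; rewrite RtoC_plus; ring).
  exact (holomorphic_on_disk_minus _ _ _ _ (holomorphic_inv_one_minus 2) Hh2 z Hz). }
assert (D0 : disk 0%C) by (unfold disk; rewrite Cmod_0; lra).
assert (Cont2 : continuous_on_disk (fun z => 2 * / (1 - z) ^ 3)%C).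
{ intros z Hz. apply (continuous_Cmult (fun _ => RtoC 2)); [apply continuous_const|].
  exact (holomorphic_continuous_on_disk _ _ (holomorphic_inv_one_minus 3) z Hz). }
assert (Re_f : forall z, Re (f z) = Re (z / (1 - z))%C).
{ intros z. rewrite Hf. unfold Re. simpl. ring. }
set (psi := fun z => (h z - g z)%C).
assert (Im_f : forall z, Im (f z) = Im (psi z)).
{ intros z. rewrite Hf. unfold psi, g, Im. simpl. ring. }
assert (Hpsi : holomorphic_on_disk psi (fun z => hprime n z * (1 + z ^ n))%C).
{ intros z Hz. replace (hprime n z * (1 + z ^ n))%C with (hprime n z - g1 z)%C
    by (unfold g1; ring).
  exact (holomorphic_on_disk_minus _ _ _ _ Hh Hg z Hz). }
assert (Image : forall w, disk_image f w <-> - / 2 < Re w).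
{ intros w. split.
  - intros [z [Hz <-]]. rewrite Re_f. exact (disk_half_plane z Hz).
  - intros Hw. destruct (shear_line n psi (Re w) Hn Hpsi Hw) as [_ Surj].
    destruct (Surj (Im w)) as [t Ht].
    exists ((Re w, t) / (1 + (Re w, t)))%C. split; [apply half_plane_disk; exact Hw|].
    apply injective_projections.
    + change (Re (f ((Re w, t) / (1 + (Re w, t)))%C) = Re w).
      rewrite Re_f, geom_half_plane_inverse by exact Hw. reflexivity.
    + etransitivity; [exact (Im_f _) | exact Ht]. }
split; [|split].
- split; [|split; [|split; [|split; [|split]]]].
  + apply (harmonic_canonical f h g (hprime n) g1 (hsecond n) g2); try assumption.
    (* In h'' + g'' the summand [hsecond n] cancels, leaving the second derivative of z/(1 - z). *)
    * intros z Hz. refine (continuous_ext _ _ _ _ (Cont2 z Hz)).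
      intros w. change (@eq C (2 * / (1 - w) ^ 3) (hsecond n w + g2 w))%C. unfold g2. ring.
    * intros z Hz. apply continuous_Cmult; [apply continuous_const|].
      apply continuous_C_iff.
      apply (@continuous_minus C_UniformSpace C_AbsRing (AbsRing_NormedModule C_AbsRing)
        (hsecond n)); [apply continuous_C_iff, (continuous_hsecond n Hn z Hz)|].
      apply (@continuous_minus C_UniformSpace C_AbsRing (AbsRing_NormedModule C_AbsRing)
        (fun z => 2 * / (1 - z) ^ 3)%C); apply continuous_C_iff;
      [exact (Cont2 z Hz) | exact (continuous_hsecond n Hn z Hz)].
  + intros z Hz. rewrite (jacobian_canonical f h g _ _ z Hf' Hh Hg Hz).
    unfold g1. rewrite Cmod_mult, Cmod_opp.
    assert (P : 0 < Cmod (hprime n z)).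
    { pose proof (disk_neq_1 z Hz). pose proof (disk_pow_neq_1 n z Hn Hz).
      assert (NZ : ((1 - z) ^ 2 * (1 - z ^ n))%C <> 0%C)
        by (apply Cmult_neq_0; [apply Cpow_nz|]; assumption).
      unfold hprime. rewrite Cmod_inv by exact NZ. apply Rinv_0_lt_compat, Cmod_gt_0, NZ. }
    assert (L : Cmod (z ^ n) < 1).
    { rewrite Cmod_pow. apply pow_lt_1_compat; [|exact Hn]. split; [apply Cmod_ge_0 | exact Hz]. }
    pose proof (Cmod_ge_0 (z ^ n)).
    assert (0 < (1 - Cmod (z ^ n)) * (1 + Cmod (z ^ n))) by nra.
    assert (0 < Cmod (hprime n z) * Cmod (hprime n z)) by nra. simpl. nra.
  + intros z1 z2 H1 H2 E.
    (* Re f = Re w, so equal values place w1 and w2 on one vertical line, where [shear_line]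
       separates points. *)
    set (w1 := (z1 / (1 - z1))%C). set (w2 := (z2 / (1 - z2))%C).
    assert (I1 : (w1 / (1 + w1))%C = z1) by exact (geom_inverse z1 H1).
    assert (I2 : (w2 / (1 + w2))%C = z2) by exact (geom_inverse z2 H2).
    assert (ER : Re w1 = Re w2) by (unfold w1, w2; rewrite <- !Re_f, E; reflexivity).
    pose proof (disk_half_plane z1 H1) as Hw. fold w1 in Hw.
    destruct (shear_line n psi (Re w1) Hn Hpsi Hw) as [Inj _].
    specialize (Inj (Im w1) (Im w2)).
    assert (P1 : (Re w1, Im w1) = w1) by (symmetry; apply surjective_pairing).
    assert (P2 : (Re w1, Im w2) = w2) by (rewrite ER; symmetry; apply surjective_pairing).
    rewrite P1, P2, I1, I2 in Inj.
    assert (EI : Im w1 = Im w2) by (apply Inj; rewrite <- !Im_f, E; reflexivity).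
    assert (w1 = w2) as EW by (rewrite <- P1, <- P2, EI; reflexivity).
    rewrite <- I1, <- I2, EW. reflexivity.
  + rewrite Hf, Hh0. apply injective_projections; simpl; field; lra.
  + rewrite (Dz_canonical f h g _ _ _ Hf' Hh Hg D0). unfold hprime.
    destruct n; [lia|]. simpl. rewrite !Cmult_0_l. field.
  + rewrite (Dzbar_canonical f h g _ _ _ Hf' Hh Hg D0). unfold g1.
    destruct n; [lia|]. simpl. rewrite !Cmult_0_l, Copp_0, Cmult_0_l.
    apply injective_projections; simpl; ring.
- apply (@open_ext C_UniformSpace (fun w => - / 2 < Re w)); [|apply open_half_plane].
  intros w. symmetry. apply Image.
- intros w1 w2 t A1 A2 Ht. apply Image. apply Image in A1. apply Image in A2.
  replace (Re ((1 - t) * w1 + t * w2)%C) with ((1 - t) * Re w1 + t * Re w2)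
    by (unfold Re; simpl; ring).
  (* One of the weights t and 1 - t is at least 1/2, hence positive, which keeps the inequality
     strict. *)
  destruct (Rle_lt_dec t (/ 2)); nra.
Qed.

(** * A point where the dilatation of the convolution has modulus at least 1 *)

Lemma cis_pow (t : R) (m : nat) : (cis t ^ m)%C = cis (INR m * t).
Proof.
induction m as [|m IH].
- simpl. unfold cis. rewrite Rmult_0_l, cos_0, sin_0. reflexivity.
- rewrite S_INR, Rmult_plus_distr_r, Rmult_1_l. simpl Cpow. rewrite IH. unfold cis.
  rewrite cos_plus, sin_plus. apply injective_projections; simpl; ring.
Qed.

Lemma exists_nontrivial_root_of_unity (m : nat) : (2 <= m)%nat ->
  exists zeta : C, (zeta ^ m)%C = 1%C /\ Cmod zeta = 1 /\ Re zeta < 1.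
Proof.
intros Hm. assert (Hm' : 2 <= INR m) by (apply (le_INR 2); exact Hm).
exists (cis (2 * (PI / INR m))). split; [|split].
- rewrite cis_pow. replace (INR m * (2 * (PI / INR m))) with (2 * PI) by (field; lra).
  unfold cis. rewrite cos_2PI, sin_2PI. reflexivity.
- unfold cis, Cmod. simpl fst. simpl snd.
  pose proof (sin2_cos2 (2 * (PI / INR m))) as E. unfold Rsqr in E.
  simpl. rewrite !Rmult_1_r, Rplus_comm, E. apply sqrt_1.
- unfold cis, Re. simpl fst. rewrite cos_2a_sin.
  assert (S : 0 < sin (PI / INR m)).
  { pose proof PI_RGT_0. apply sin_gt_0.
    - apply Rdiv_lt_0_compat; lra.
    - apply Rmult_lt_reg_r with (INR m); [lra|].
      unfold Rdiv. rewrite Rmult_assoc, Rinv_l by lra. nra. }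
  nra.
Qed.

(** The expression is the cofactor of 4 (1 - r^(n+1)) in |z^n p|^2 - |q|^2 at z = r zeta with c = Re
    zeta. At r = 1 it equals 2 (n - 2)(1 - c), positive for n >= 3, and it stays positive for r near
    1 by continuity. *)
Lemma exists_radius (n : nat) (c : R) : (3 <= n)%nat -> c < 1 ->
  exists r : R, 0 < r < 1 /\
    0 < (r ^ n) ^ 2 * (INR n - 1 - r ^ S n) - 1 + (INR n - 1) * r ^ S n
        - (INR n - 2) * c * r ^ n * (1 + r ^ S n).
Proof.
intros Hn Hc. assert (Hn' : 3 <= INR n) by (replace 3 with (INR 3) by (simpl; ring); apply le_INR, Hn).
set (E := fun r => (r ^ n) ^ 2 * (INR n - 1 - r ^ S n) - 1 + (INR n - 1) * r ^ S n
        - (INR n - 2) * c * r ^ n * (1 + r ^ S n)).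
assert (E1 : 0 < E 1) by (unfold E; rewrite !pow1; nra).
assert (CE : continuous E 1).
{ apply (@ex_derive_continuous R_AbsRing R_NormedModule). unfold E. auto_derive. exact I. }
destruct (CE (fun y => 0 < y) (open_gt 0 _ E1)) as [d Hd].
pose proof (cond_pos d) as Pd.
set (e := Rmin (d / 2) (1 / 2)).
assert (He : 0 < e) by (apply Rmin_pos; lra).
pose proof (Rmin_l (d / 2) (1 / 2)) as L1. pose proof (Rmin_r (d / 2) (1 / 2)) as L2. fold e in L1, L2.
exists (1 - e). split; [lra|]. apply (Hd (1 - e)).
change (Rabs (1 - e - 1) < d). rewrite Rabs_left; lra.
Qed.

(* On |z| = 1 the two sides agree; at a nontrivial (n+1)-st root of unity
   the radial derivative of |z^n p / q| is negative. *)
Lemma exists_dilatation_ge_1 (n : nat) : (3 <= n)%nat ->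
  exists z : C, disk z /\
    Cmod (2 + (INR n - 2) * z ^ n - INR n * z ^ S n) <=
    Cmod (z ^ n * (INR n - (INR n - 2) * z - 2 * z ^ S n)).
Proof.
intros Hn.
destruct (exists_nontrivial_root_of_unity (S n) ltac:(lia)) as (zeta & Hz1 & Hzm & Hzr).
destruct (exists_radius n (Re zeta) Hn Hzr) as (r & Hr & HE).
set (z := (r * zeta)%C). exists z.
assert (Hzmod : Cmod z = r) by (unfold z; rewrite Cmod_mult, Cmod_R, Hzm, Rabs_pos_eq; lra).
split; [unfold disk; lra|].
set (s := r ^ S n) in *. set (N := INR n) in *. set (c := Re zeta) in *. set (sg := Im zeta).
assert (Hcs : c * c + sg * sg = 1).
{ unfold c, sg. rewrite <- Cmod_sqr, Hzm. ring. }
assert (Hs : (z ^ S n)%C = s) by (unfold z, s; rewrite Cpow_mult_l, Hz1, RtoC_pow; ring).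
(* Here zeta^n = 1/zeta = conj(zeta), so both moduli depend on zeta only through its real part. *)
assert (Hzn : (z ^ n)%C = (r ^ n * Cconj zeta)%C).
{ assert (Hz0 : z <> 0%C) by (apply Cmod_gt_0; lra).
  assert (Q : (z * z ^ n = z * (r ^ n * Cconj zeta))%C).
  { change (z * z ^ n)%C with (z ^ S n)%C. rewrite Hs. unfold z, s.
    replace (r * zeta * (r ^ n * Cconj zeta))%C with (r * r ^ n * (zeta * Cconj zeta))%C by ring.
    rewrite <- Cmod2_conj, Hzm. rewrite <- RtoC_pow. simpl pow. rewrite !RtoC_mult. ring. }
  replace (z ^ n)%C with (/ z * (z * z ^ n))%C by (field; exact Hz0).
  rewrite Q. field. exact Hz0. }
rewrite Cmod_mult, Cmod_pow, Hzmod, Hs, Hzn.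
rewrite <- RtoC_pow.
set (R := r ^ n) in *.
assert (Es : s = r * R) by reflexivity.
assert (HR : 0 < R) by (apply pow_lt; lra).
assert (HR1 : R < 1) by (apply pow_lt_1_compat; [lra | lia]).
assert (Hs1 : s < 1) by (rewrite Es; nra).
assert (P1 : Cmod (2 + (N - 2) * (R * Cconj zeta) - N * s) ^ 2 =
  (2 + (N - 2) * R * c - N * s) ^ 2 + ((N - 2) * R * sg) ^ 2).
{ rewrite Cmod_sqr. unfold c, sg, Re, Im. simpl. ring. }
assert (P2 : Cmod (N - (N - 2) * z - 2 * s) ^ 2 =
  (N - (N - 2) * r * c - 2 * s) ^ 2 + ((N - 2) * r * sg) ^ 2).
{ rewrite Cmod_sqr. unfold z, c, sg, Re, Im. simpl. ring. }
apply Rsqr_incr_0_var; [|apply Rmult_le_pos; [lra | apply Cmod_ge_0]].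
unfold Rsqr.
replace (Cmod (2 + (N - 2) * (R * Cconj zeta) - N * s) * Cmod (2 + (N - 2) * (R * Cconj zeta) - N * s))
  with (Cmod (2 + (N - 2) * (R * Cconj zeta) - N * s) ^ 2) by ring.
replace (R * Cmod (N - (N - 2) * z - 2 * s) * (R * Cmod (N - (N - 2) * z - 2 * s)))
  with (R ^ 2 * Cmod (N - (N - 2) * z - 2 * s) ^ 2) by ring.
rewrite P1, P2.
set (br := R ^ 2 * (N - 1 - s) - 1 + (N - 1) * s - (N - 2) * c * R * (1 + s)) in *.
apply Rminus_le.
(* The factor 1 - s splits off because the two moduli agree at r = 1; the remaining sign is that
   supplied by [exists_radius]. *)
replace (_ - _) with (- (4 * ((1 - s) * br))).
- assert (0 < (1 - s) * br) by (apply Rmult_lt_0_compat; lra). lra.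
- unfold br. replace (sg * sg) with (1 - c * c) by lra.
  replace (((N - 2) * R * sg) ^ 2) with ((N - 2) ^ 2 * R ^ 2 * (1 - c * c))
    by (replace (1 - c * c) with (sg * sg) by lra; ring).
  replace (((N - 2) * r * sg) ^ 2) with ((N - 2) ^ 2 * r ^ 2 * (1 - c * c))
    by (replace (1 - c * c) with (sg * sg) by lra; ring).
  rewrite Es. ring.
Qed.

(** * The convolution with f0 *)

Lemma holomorphic_analytic (h h1 : C -> C) : holomorphic_on_disk h h1 -> analytic_on_disk h.
Proof. intros H z Hz. exists (h1 z). exact (H z Hz). Qed.

Definition geom_tail (k : nat) : C := match k with O => RtoC 0 | S _ => RtoC 1 end.

Lemma has_expansion_geom_tail :
  has_expansion (fun z => z / (1 - z))%C geom_tail /\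
  has_expansion (fun z => z / (1 - z) ^ 2)%C (fun k => INR k).
Proof.
destruct (has_expansion_geom 1 ltac:(lia)) as [B0 E0].
assert (G1 : forall k, geom_coeff 1 k = 1%C).
{ intros k. unfold geom_coeff. rewrite Nat.mod_1_r. reflexivity. }
destruct (has_expansion_partial_sums _ _ _ B0 E0) as [_ E1].
assert (G2 : forall k, (@sum_n C_AbelianMonoid (geom_coeff 1) k : C) = INR (S k)).
{ induction k as [|k IH].
  - rewrite sum_O, G1. reflexivity.
  - rewrite sum_Sn, IH, G1, (S_INR (S k)), RtoC_plus. reflexivity. }
split.
- apply (has_expansion_ext _ _ _ _ (has_expansion_shift _ _ E0)).
  + intros z Hz. pose proof (disk_neq_1 z Hz). replace (z ^ 1)%C with z by (simpl; ring).
    field. assumption.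
  + intros [|k]; [reflexivity | exact (G1 k)].
- apply (has_expansion_ext _ _ _ _ (has_expansion_shift _ _ E1)).
  + intros z Hz. pose proof (disk_neq_1 z Hz). replace (z ^ 1)%C with z by (simpl; ring).
    field. assumption.
  + intros [|k]; [reflexivity | exact (G2 k)].
Qed.

Definition h0 (z : C) : C := ((z - / 2 * z ^ 2) / (1 - z) ^ 2)%C.
Definition g0 (z : C) : C := (- (/ 2 * z ^ 2 / (1 - z) ^ 2))%C.

(** On functions vanishing at 0, convolution with z/(1 - z) is the identity and with z/(1 - z)^2 it
    is phi -> z phi'. The decomposition therefore explains (h + z h')/2, and its companion for [g0]
    explains (g - z g')/2. *)
Lemma h0_partial_fractions (z : C) : disk z ->
  h0 z = (/ 2 * (z / (1 - z) + z / (1 - z) ^ 2))%C.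
Proof.
intros Hz. pose proof (disk_neq_1 z Hz). unfold h0. field. assumption.
Qed.

Lemma g0_partial_fractions (z : C) : disk z ->
  g0 z = (/ 2 * (z / (1 - z) - z / (1 - z) ^ 2))%C.
Proof.
intros Hz. pose proof (disk_neq_1 z Hz). unfold g0. field. assumption.
Qed.

Lemma f0_canonical : canonical_decomposition f0 h0 g0.
Proof.
assert (A : holomorphic_on_disk (fun z => z / (1 - z) ^ 2)%C
  (fun z => 1 * / (1 - z) ^ 2 + z * (INR 2 * / (1 - z) ^ 3))%C).
{ intros z Hz. apply (is_Cderive_mult (fun z => z) (fun z => / (1 - z) ^ 2)%C);
    [apply is_Cderive_id | apply (holomorphic_inv_one_minus 2 z Hz)]. }
split; [|split; [|split; [|split]]].
- intros z Hz. eexists.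
  apply (is_Cderive_ext_disk (fun z => / 2 * (z / (1 - z) + z / (1 - z) ^ 2))%C); [|exact Hz|].
  + intros w Hw. symmetry. exact (h0_partial_fractions w Hw).
  + exact (holomorphic_on_disk_scal _ _ _ (holomorphic_on_disk_plus _ _ _ _ holomorphic_geom A) z Hz).
- intros z Hz. eexists.
  apply (is_Cderive_ext_disk (fun z => / 2 * (z / (1 - z) - z / (1 - z) ^ 2))%C); [|exact Hz|].
  + intros w Hw. symmetry. exact (g0_partial_fractions w Hw).
  + exact (holomorphic_on_disk_scal _ _ _ (holomorphic_on_disk_minus _ _ _ _ holomorphic_geom A) z Hz).
- unfold h0. field.
- unfold g0. field.
- intros z Hz. unfold f0, h0, g0. rewrite Copp_conj. reflexivity.
Qed.

Theorem mainTheorem3 :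
  forall n : nat, (3 <= n)%nat ->
  exists (theta : R) (f h g : C -> C),
    K_HO f /\
    canonical_decomposition f h g /\
    (forall z : C, disk z -> (h z + g z = z / (1 - z))%C) /\
    (forall z : C, disk z ->
       (C_derive g z / C_derive h z = cis theta * z ^ n)%C) /\
    exists F : C -> C, is_harmonic_convolution f0 f F /\ ~ S_HO F.
Proof.
intros n Hn3. assert (Hn : (0 < n)%nat) by lia.
destruct (exists_antiderivative_hprime n Hn) as (h & a & Eh & Ha0 & Hh & Ezh).
assert (Hh0 : h 0%C = 0%C) by (rewrite (has_expansion_at_0 h a Eh); exact Ha0).
set (g := fun z => (z / (1 - z) - h z)%C).
set (g1 := fun z => (/ (1 - z) ^ 2 - hprime n z)%C).
set (g2 := fun z => (INR 2 * / (1 - z) ^ 3 - hsecond n z)%C).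
set (f := fun z => (h z + Cconj (g z))%C).
assert (Hg : holomorphic_on_disk g g1) by exact (holomorphic_on_disk_minus _ _ _ _ holomorphic_geom Hh).
assert (Hh1 := holomorphic_hprime n Hn).
assert (Hg1 : holomorphic_on_disk g1 g2)
  by exact (holomorphic_on_disk_minus _ _ _ _ (holomorphic_inv_one_minus 2) Hh1).
destruct has_expansion_geom_tail as [Eg1 Eg2].
assert (Can : canonical_decomposition f h g).
{ split; [exact (holomorphic_analytic _ _ Hh)|].
  split; [exact (holomorphic_analytic _ _ Hg)|]. split; [exact Hh0|]. split; [|reflexivity].
  unfold g. rewrite Hh0. field. }
exists PI, f, h, g. split; [|split; [|split; [|split]]].
- exact (shear_K_HO n f h Hn Hh Hh0 (fun z => eq_refl)).
- exact Can.
- intros z Hz. unfold g. ring.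
- intros z Hz.
  rewrite (is_C_derive_unique g z (g1 z) (Hg z Hz)), (is_C_derive_unique h z (hprime n z) (Hh z Hz)).
  unfold cis. rewrite cos_PI, sin_PI. change (-1, 0) with (RtoC (-1)).
  pose proof (disk_neq_1 z Hz). pose proof (disk_pow_neq_1 n z Hn Hz).
  unfold g1, hprime. field. split; assumption.
- set (k := fun z => (/ 2 * (h z + z * hprime n z))%C).
  set (l := fun z => (/ 2 * (g z - z * g1 z))%C).
  set (F := fun z => (k z + Cconj (l z))%C).
  exists F. split.
  + exists h0, g0, h, g, k, l.
    split; [exact f0_canonical|]. split; [exact Can|]. split; [|split; [|reflexivity]].
    * exists (fun m => / 2 * (geom_tail m + INR m))%C, a. split; [|split; [exact Eh|]].
      -- apply (has_expansion_ext _ _ _ _ (has_expansion_scal (/ 2) _ _ (has_expansion_plus _ _ _ _ Eg1 Eg2)));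
           [|reflexivity].
         intros z Hz. symmetry. exact (h0_partial_fractions z Hz).
      -- apply (has_expansion_ext _ _ _ _ (has_expansion_scal (/ 2) _ _ (has_expansion_plus _ _ _ _ Eh Ezh)));
           [reflexivity|].
         (* The formula (1 + m)/2 for the coefficients of [h0] fails at m = 0, where the coefficient
            is 0; there [a O = 0] is what makes both sides agree. *)
         intros [|m]; simpl geom_tail; [rewrite Ha0|]; ring.
    * exists (fun m => / 2 * (geom_tail m - INR m))%C, (fun m => geom_tail m - a m)%C.
      split; [|split].
      -- apply (has_expansion_ext _ _ _ _ (has_expansion_scal (/ 2) _ _ (has_expansion_minus _ _ _ _ Eg1 Eg2)));
           [|reflexivity].
         intros z Hz. symmetry. exact (g0_partial_fractions z Hz).
      -- exact (has_expansion_minus _ _ _ _ Eg1 Eh).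
      -- apply (has_expansion_ext _ _ _ _ (has_expansion_scal (/ 2) _ _
           (has_expansion_minus _ _ _ _ (has_expansion_minus _ _ _ _ Eg1 Eh)
             (has_expansion_minus _ _ _ _ Eg2 Ezh)))).
         ++ intros z Hz. unfold l, g, g1, Cdiv. ring.
         ++ intros [|m]; simpl geom_tail; [rewrite Ha0; simpl|]; ring.
  + intros (_ & SP & _).
    destruct (exists_dilatation_ge_1 n Hn3) as (z & Hz & Hle).
    specialize (SP z Hz).
    assert (Hid : forall phi phi1, holomorphic_on_disk phi phi1 ->
      holomorphic_on_disk (fun z => z * phi z)%C (fun z => 1 * phi z + z * phi1 z)%C).
    { intros phi phi1 H w Hw. apply (is_Cderive_mult (fun w => w)); [apply is_Cderive_id | exact (H w Hw)]. }
    assert (Hk := holomorphic_on_disk_scal (/ 2) _ _ (holomorphic_on_disk_plus _ _ _ _ Hh (Hid _ _ Hh1))).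
    assert (Hl := holomorphic_on_disk_scal (/ 2) _ _ (holomorphic_on_disk_minus _ _ _ _ Hg (Hid _ _ Hg1))).
    rewrite (jacobian_canonical F k l _ _ z (fun z _ => eq_refl) Hk Hl Hz) in SP.
    cbv beta in SP.
    pose proof (disk_neq_1 z Hz) as N1. pose proof (disk_pow_neq_1 n z Hn Hz) as N2.
    (* The common factor of k' and l': k' = c q and l' = c z^n p, so the Jacobian is |c|^2 (|q|^2 -
       |z^n p|^2). *)
    set (c := (/ 2 * / (1 - z) ^ 3 * / (1 - z ^ n) ^ 2)%C).
    (* [hsecond] contains z^(n-1). Writing every power through it and generalizing leaves rational
       identities in z, z^(n-1) and n for [field]. *)
    assert (Z : (z * z ^ pred n = z ^ n)%C) by (destruct n; [lia | reflexivity]).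
    replace (/ 2 * (hprime n z + (1 * hprime n z + z * hsecond n z)))%C
      with (c * (2 + (INR n - 2) * z ^ n - INR n * z ^ S n))%C in SP.
    2:{ unfold c, hprime, hsecond. change (z ^ S n)%C with (z * z ^ n)%C. rewrite <- Z in *.
        generalize dependent (z ^ pred n)%C. generalize (INR n). intros. field. split; assumption. }
    replace (/ 2 * (g1 z - (1 * g1 z + z * g2 z)))%C
      with (c * (z ^ n * (INR n - (INR n - 2) * z - 2 * z ^ S n)))%C in SP.
    2:{ unfold c, g1, g2, hprime, hsecond. change (z ^ S n)%C with (z * z ^ n)%C. rewrite <- Z in *.
        change (INR 2) with (1 + 1). rewrite RtoC_plus.
        generalize dependent (z ^ pred n)%C. generalize (INR n). intros. field. split; assumption. }
    rewrite !(Cmod_mult c) in SP.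
    assert (L : Cmod c * Cmod (2 + (INR n - 2) * z ^ n - INR n * z ^ S n) <=
      Cmod c * Cmod (z ^ n * (INR n - (INR n - 2) * z - 2 * z ^ S n)))
      by (apply Rmult_le_compat_l; [apply Cmod_ge_0 | exact Hle]).
    assert (L2 := pow_incr _ _ 2 (conj (Rmult_le_pos _ _ (Cmod_ge_0 c) (Cmod_ge_0 _)) L)).
    lra.
Qed.
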